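(* The reduced marked-graph bracket polynomial $\langle G\rangle$ is invariant under marked local complementations and under marked-graph Reidemeister moves of types $\Omega.2$ and $\Omega.3$. The marked-graph Jones polynomial $V_G(t)$ is invariant under marked local complementations and under all three types $\Omega.1,\Omega.2,\Omega.3$ of marked-graph Reidemeister moves.
   Context: A marked graph is a finite undirected graph $G$ without multiple edges, in which each vertex may be looped or unlooped, each vertex is either unmarked or carries one of the marks $r,c,cr,u,ur$, together with a number $\phi\ge 0$ of free loops (extra components with no vertices or edges). ''Adjacent'' and ''neighbor'' refer to distinct vertices; a vertex is isolated if it has no neighbors (it may be looped). $G-v-w$ is obtained by deleting the vertices $v,w$ and keeping everything else, including free loops. Marked local complement: for $v\in V(G)$, $G_{cru}^v$ is obtained from $G$ by making exactly these changes. (i) The mark of $v$ changes by unmarked $\leftrightarrow u$, $r\leftrightarrow ur$, $c\leftrightarrow cr$. (ii) The mark of each neighbor of $v$ changes by unmarked $\leftrightarrow r$, $c\leftrightarrow ur$, $u\leftrightarrow cr$. (iii) For any two distinct neighbors $x,y$ of $v$, the adjacency between $x$ and $y$ is toggled. Loops and free loops are not changed. For adjacent $v\ne w$ the marked pivot is $G_{cru}^{vw}=((G_{cru}^v)_{cru}^w)_{cru}^v$. Reidemeister moves. $\Omega.1$: adjoin or remove an isolated vertex (looped or unlooped) that is unmarked or marked $u$. $\Omega.2$: any of the following, or its inverse, where $v$ is a looped vertex and $w$ an unlooped vertex of $G$. (a) $v,w$ are both unmarked and have the same neighbors outside $\{v,w\}$: replace $G$ with $G-v-w$. (b) $v$ is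 marked $c$, $w$ is unmarked, $v$ is the only neighbor of $w$, and $z\notin\{v,w\}$ is a neighbor of $v$: replace $G$ with $G_{cru}^{vz}-v-w$. (c) $v$ is marked $c$, $w$ is unmarked, $v$ and $w$ have the same neighbors outside $\{v,w\}$, and $z\notin\{v,w\}$ is a neighbor of $v$ and $w$: replace $G$ with $G_{cru}^{vz}-v-w$. (d) $v$ is marked $c$, $w$ is unmarked, $v$ is the only neighbor of $w$, and $w$ is the only neighbor of $v$: replace $G$ with $G^+-v-w$, where $G^+$ is $G$ with one additional free loop. $\Omega.3$: suppose $u,v,w$ are three unmarked, pairwise adjacent vertices of $G$, $u$ is looped, $v$ and $w$ are unlooped, and every vertex $x\notin\{u,v,w\}$ is adjacent to either none or precisely two of $u,v,w$; replace $G$ with the graph obtained by removing the three edges $\{u,v\},\{u,w\},\{v,w\}$. The inverse of an $\Omega.3$ move, the composition of an $\Omega.3$ move with $\Omega.2$ moves, and the mirror image of an $\Omega.3$ move (toggle all loops, apply an $\Omega.3$ move, toggle all loops again) are also $\Omega.3$ moves. For each $i\in\{1,2,3\}$, a marked-graph Reidemeister move of type $\Omega.i$ consists of marked local complementations, followed by one $\Omega.i$ move, followed by marked local complementations. Bracket: let $V(G)=\{v_1,\dots,v_n\}$. The Boolean adjacency matrix $\mathcal{A}(G)$ is the $n\times n$ matrix over $GF(2)$ with $(i,j)$ entry ($i\neq j$) equal to $1$ iff $v_i,v_j$ are adjacent, and $(i,i)$ entry equal to $1$ iff $v_i$ is looped. For $T\subseteq V(G)$, $\Delta_T$ is the diagonal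 matrix over $GF(2)$ whose $i$-th diagonal entry is $1$ iff either $v_i\in T$ and the mark of $v_i$ does not involve the letter $r$, or $v_i\notin T$ and the mark of $v_i$ involves $r$ (being unmarked counts as not involving $r$). $\mathcal{A}(G)_T$ is the submatrix of $\mathcal{A}(G)+\Delta_T$ obtained by removing the $i$-th row and column whenever either $v_i$ is marked $c$ or $cr$ and $(\mathcal{A}(G)+\Delta_T)_{ii}=0$, or $v_i$ is marked $u$ or $ur$ and $(\mathcal{A}(G)+\Delta_T)_{ii}=1$. Then $[G]=d^{\phi}\sum_{T\subseteq V(G)}A^{n-|T|}B^{|T|}d^{\nu(\mathcal{A}(G)_T)}$, where $\nu$ denotes $GF(2)$-nullity (the empty matrix has nullity $0$). The reduced bracket $\langle G\rangle\in\mathbb{Z}[A,A^{-1}]$ is the image of $[G]$ under $B\mapsto A^{-1}$, $d\mapsto -A^{-2}-A^{2}$. If $G$ has $n$ vertices, $\ell$ of them looped, the marked-graph Jones polynomial is $$V_G(t)=(-1)^n\,t^{(3n-6\ell)/4}\,\langle G\rangle(t^{-1/4}),$$ i.e. $A$ is evaluated at $t^{-1/4}$.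
   Formalization: In move Ω.2(c), v and w are additionally assumed adjacent; without this it fails: on the path v–z–w with v looped and marked c, and z, w unlooped and unmarked, the reduced bracket is 2A+A^{-1}-A^{-5} before and A+A^{-1} after. *)

(* Defs.v *)
From HB Require Import structures.
From mathcomp Require Import all_boot all_order all_algebra.
From mathcomp Require Import fraction mpoly.

Set Implicit Arguments.
Unset Strict Implicit.
Unset Printing Implicit Defensive.

Import GRing.Theory.

Local Open Scope ring_scope.

(*  [@LaurentPoly (p, k) _] stands for p / X^k in lowest terms: an element has a
    unique representation.  [laurent] is embedded into the field of fractions
    of {poly int} by [lfrac], and this is how the ring axioms are proved. *)

Definition lowest_terms (pk : {poly int} * nat) : bool :=
  (pk.2 == 0%N) || (pk.1`_0 != 0).

Record laurent := LaurentPoly {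
  lrep : {poly int} * nat;
  _ : lowest_terms lrep
}.

HB.instance Definition _ := [isSub for lrep].
HB.instance Definition _ := [Choice of laurent by <:].

Definition lnum (x : laurent) : {poly int} := (lrep x).1.
Definition lden (x : laurent) : nat := (lrep x).2.

Fixpoint reduce_terms (p : {poly int}) (k : nat) : {poly int} * nat :=
  if k is k'.+1 then
    if p`_0 == 0 then reduce_terms (drop_poly 1 p) k' else (p, k)
  else (p, 0%N).

Lemma reduce_termsP p k : lowest_terms (reduce_terms p k).
Proof.
elim: k p => [|k IHk] p //=; case: ifP => [_ | p0]; first exact: IHk.
by rewrite /lowest_terms /= p0.
Qed.

Definition mklaurent (p : {poly int}) (k : nat) : laurent :=
  LaurentPoly (reduce_termsP p k).

Local Notation frac := (@FracField.tofrac {poly int}).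

Definition lfrac (x : laurent) : {fraction {poly int}} :=
  frac (lnum x) / frac 'X ^+ lden x.

Lemma fracX_neq0 k : frac 'X ^+ k != 0.
Proof. by rewrite expf_neq0 // tofrac_eq0 polyX_eq0. Qed.

Lemma lfracE p k : lfrac (mklaurent p k) = frac p / frac 'X ^+ k.
Proof.
rewrite /lfrac /lnum /lden /=; elim: k p => [|k IHk] p //=.
case: ifP => // /eqP p0; rewrite IHk -[in RHS](poly_take_drop 1 p).
have -> : take_poly 1 p = 0.
  by apply/polyP=> -[|i]; rewrite coef_take_poly coef0.
rewrite add0r expr1 tofracM exprS invfM mulrA mulfK //.
exact: (fracX_neq0 1).
Qed.

Lemma lfrac_inj : injective lfrac.
Proof.
move=> x y; rewrite /lfrac => /eqP.
rewrite eqr_div ?fracX_neq0 // -!tofracXn -!tofracM tofrac_eq => /eqP exy.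
apply: val_inj; move: exy; case: x y => [[p k] hp] [[q l] hq] /=.
rewrite /lnum /lden /= => e.
wlog lkl : p k hp q l hq e / (k <= l)%N.
  by move=> H; case/orP: (leq_total k l) => h; [|symmetry]; apply: H.
rewrite -(subnK lkl) exprD mulrA in e.
have {}e : p * 'X^(l - k) = q.
  by apply: (mulIf _ e); rewrite expf_neq0 ?polyX_eq0.
have [e0|lt0] := posnP (l - k)%N.
  rewrite e0 expr0 mulr1 in e; rewrite e; congr (_, _).
  by apply/eqP; rewrite eqn_leq lkl -subn_eq0 e0.
move: hq; rewrite -e /lowest_terms /= coefMXn lt0 eqxx orbF => /eqP l0.
by rewrite l0 sub0n in lt0.
Qed.

Definition lzero : laurent := mklaurent 0 0.
Definition lone : laurent := mklaurent 1 0.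
Definition lopp (x : laurent) : laurent := mklaurent (- lnum x) (lden x).
Definition ladd (x y : laurent) : laurent :=
  mklaurent (lnum x * 'X^(lden y) + lnum y * 'X^(lden x)) (lden x + lden y).
Definition lmul (x y : laurent) : laurent :=
  mklaurent (lnum x * lnum y) (lden x + lden y).

Lemma lfrac0 : lfrac lzero = 0.
Proof. by rewrite lfracE tofrac0 mul0r. Qed.

Lemma lfrac1 : lfrac lone = 1.
Proof. by rewrite lfracE tofrac1 expr0 divr1. Qed.

Lemma lfracN x : lfrac (lopp x) = - lfrac x.
Proof. by rewrite lfracE tofracN mulNr. Qed.

Lemma lfracD x y : lfrac (ladd x y) = lfrac x + lfrac y.
Proof.
rewrite lfracE /lfrac tofracD !tofracM !tofracXn.
by rewrite addf_div ?fracX_neq0 // exprD.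
Qed.

Lemma lfracM x y : lfrac (lmul x y) = lfrac x * lfrac y.
Proof. by rewrite lfracE /lfrac tofracM exprD mulf_div. Qed.

Definition lfracS := (lfrac0, lfrac1, lfracN, lfracD, lfracM).

Fact laddA : associative ladd.
Proof. by move=> x y z; apply: lfrac_inj; rewrite !lfracS addrA. Qed.
Fact laddC : commutative ladd.
Proof. by move=> x y; apply: lfrac_inj; rewrite !lfracS addrC. Qed.
Fact ladd0 : left_id lzero ladd.
Proof. by move=> x; apply: lfrac_inj; rewrite !lfracS add0r. Qed.
Fact laddN : left_inverse lzero lopp ladd.
Proof. by move=> x; apply: lfrac_inj; rewrite !lfracS addNr. Qed.
HB.instance Definition _ := GRing.isZmodule.Build laurent laddA laddC ladd0 laddN.

Fact lmulA : associative lmul.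
Proof. by move=> x y z; apply: lfrac_inj; rewrite !lfracS mulrA. Qed.
Fact lmulC : commutative lmul.
Proof. by move=> x y; apply: lfrac_inj; rewrite !lfracS mulrC. Qed.
Fact lmul1 : left_id lone lmul.
Proof. by move=> x; apply: lfrac_inj; rewrite !lfracS mul1r. Qed.
Fact lmulD : left_distributive lmul ladd.
Proof. by move=> x y z; apply: lfrac_inj; rewrite !lfracS mulrDl. Qed.
Fact lone_neq0 : lone != lzero.
Proof. by apply/eqP=> /(congr1 lfrac)/eqP; rewrite !lfracS oner_eq0. Qed.
HB.instance Definition _ :=
  GRing.Zmodule_isComNzRing.Build laurent lmulA lmulC lmul1 lmulD lone_neq0.

(* The units of Z[X, 1/X] are the elements a * X^m, with a = 1 or a = -1. *)
Definition lunit (x : laurent) : bool :=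
  (lead_coef (lnum x) \is a GRing.unit) &&
  (lnum x == lead_coef (lnum x) *: 'X^((size (lnum x)).-1)).

Definition linv (x : laurent) : laurent :=
  if lunit x then
    mklaurent ((lead_coef (lnum x))^-1 *: 'X^(lden x)) (size (lnum x)).-1
  else x.

Fact lmulV : {in lunit, left_inverse 1 linv *%R}.
Proof.
move=> x; rewrite -topredE /= => ux; rewrite /linv ux; case/andP: ux => ua /eqP ex.
apply: lfrac_inj; rewrite [LHS]lfracM lfracE [RHS]lfrac1 /lfrac [in frac (lnum x)]ex.
rewrite mulf_div -tofracM -scalerAl -scalerAr scalerA mulVr // scale1r.
by rewrite tofracM !tofracXn -!exprD addnC divff ?fracX_neq0.
Qed.

Fact lunitPl (x y : laurent) : y * x = 1 -> lunit x.
Proof.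
move=> /(congr1 lfrac); rewrite [LHS]lfracM [RHS]lfrac1 /lfrac mulf_div -exprD => /eqP.
rewrite -[1]divr1 eqr_div ?oner_eq0 ?fracX_neq0 // mulr1 mul1r.
rewrite -tofracXn -tofracM tofrac_eq => /eqP; move: (lden y + lden x)%N => n e.
have l1 : lead_coef (lnum y) * lead_coef (lnum x) = 1.
  by rewrite -lead_coefM e lead_coefXn.
have ua : lead_coef (lnum x) \is a GRing.unit.
  by apply/unitrPr; exists (lead_coef (lnum y)); rewrite mulrC.
rewrite /lunit ua /=.
have : lnum x %| ('X - 0%:P) ^+ n by rewrite subr0 -e dvdp_mulIr.
case/dvdp_exp_XsubCP => k _ /eqpP[[a b] /= /andP[a0 b0]].
rewrite subr0 => exk.
have sz : (size (lnum x)).-1 = k.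
  by rewrite -(size_scale _ a0) exk size_scale // size_polyXn.
have lc : a * lead_coef (lnum x) = b.
  by rewrite -lead_coefZ exk lead_coefZ lead_coefXn mulr1.
rewrite sz; apply/eqP/(mulfI (_ : a%:P != 0)); first by rewrite polyC_eq0.
by rewrite !mul_polyC scalerA lc.
Qed.

Fact linv_out : {in [predC lunit], linv =1 id}.
Proof. by move=> x; rewrite inE /= /linv -topredE /= => /negbTE->. Qed.

HB.instance Definition _ :=
  GRing.ComNzRing_hasMulInverse.Build laurent lmulV lunitPl linv_out.

Definition lX : laurent := mklaurent 'X 0.

(* Substitution of x for the variable; meaningful when x is a unit. *)
Definition leval (S : comUnitRingType) (p : laurent) (x : S) : S :=
  (map_poly intr (lnum p)).[x] / x ^+ lden p.

Inductive mark : Set := unmarked | mr | mc | mcr | mu | mur.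

Definition involves_r (m : mark) : bool :=
  match m with mr | mcr | mur => true | _ => false end.

Definition is_c_or_cr (m : mark) : bool :=
  match m with mc | mcr => true | _ => false end.

Definition is_u_or_ur (m : mark) : bool :=
  match m with mu | mur => true | _ => false end.

Record mgraph := MGraph {
  vertex :> finType;
  adj : rel vertex;
  adj_sym : ssrbool.symmetric adj;
  adj_irr : irreflexive adj;
  looped : pred vertex;
  marking : vertex -> mark;
  free_loops : nat
}.

Arguments adj {m} : rename.
Arguments looped {m} : rename.
Arguments marking {m} : rename.

Definition mgraph_iso (G H : mgraph) : Prop :=
  exists f : G -> H,
    [/\ bijective f,
        forall x y, adj (f x) (f y) = adj x y,
        forall x, looped (f x) = looped x,
        forall x, marking (f x) = marking x
      & free_loops H = free_loops G].

Section Operations.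

Variable G : mgraph.

Definition mark_lc_self (m : mark) : mark :=
  match m with
  | unmarked => mu  | mu => unmarked
  | mr => mur       | mur => mr
  | mc => mcr       | mcr => mc
  end.

Definition mark_lc_neighbor (m : mark) : mark :=
  match m with
  | unmarked => mr  | mr => unmarked
  | mc => mur       | mur => mc
  | mu => mcr       | mcr => mu
  end.

Definition lc_adj (v : G) : rel G :=
  fun x y => adj x y (+) [&& x != y, adj v x & adj v y].

Lemma lc_adj_sym v : ssrbool.symmetric (lc_adj v).
Proof. by move=> x y; rewrite /lc_adj adj_sym eq_sym [adj v x && _]andbC. Qed.

Lemma lc_adj_irr v : irreflexive (lc_adj v).
Proof. by move=> x; rewrite /lc_adj adj_irr eqxx. Qed.

Definition lc_marking (v x : G) : mark :=
  if x == v then mark_lc_self (marking x)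
  else if adj v x then mark_lc_neighbor (marking x)
  else marking x.

Definition lc (v : G) : mgraph :=
  MGraph (lc_adj_sym v) (lc_adj_irr v) looped (lc_marking v) (free_loops G).

Definition del_adj (S : {set G}) : rel {x : G | x \notin S} :=
  fun x y => adj (val x) (val y).

Lemma del_adj_sym S : ssrbool.symmetric (@del_adj S).
Proof. by move=> x y; apply: adj_sym. Qed.

Lemma del_adj_irr S : irreflexive (@del_adj S).
Proof. by move=> x; apply: adj_irr. Qed.

Definition delete (S : {set G}) : mgraph :=
  MGraph (@del_adj_sym S) (@del_adj_irr S)
    (fun x => looped (val x)) (fun x => marking (val x)) (free_loops G).

Definition add_free_loop : mgraph :=
  MGraph (@adj_sym G) (@adj_irr G) looped marking (free_loops G).+1.

Definition mirror : mgraph :=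
  MGraph (@adj_sym G) (@adj_irr G) (fun x => ~~ looped x) marking (free_loops G).

Definition cut_adj (S : {set G}) : rel G :=
  fun x y => adj x y && ~~ ((x \in S) && (y \in S)).

Lemma cut_adj_sym S : ssrbool.symmetric (cut_adj S).
Proof. by move=> x y; rewrite /cut_adj adj_sym [(x \in S) && _]andbC. Qed.

Lemma cut_adj_irr S : irreflexive (cut_adj S).
Proof. by move=> x; rewrite /cut_adj adj_irr. Qed.

(* S induces no edge in the result; edges leaving S are kept. *)
Definition cut_edges (S : {set G}) : mgraph :=
  MGraph (cut_adj_sym S) (cut_adj_irr S) looped marking (free_loops G).

End Operations.

(* [lc] does not change the vertex type, so that v and w are vertices of all
   the intermediate graphs. *)
Definition pivot (G : mgraph) (v w : G) : mgraph :=
  @lc (@lc (@lc G v) w) v.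

Arguments add_free_loop G : clear implicits.
Arguments mirror G : clear implicits.

(* The graph produced by a move is specified up to isomorphism. *)

Definition omega1_remove (G H : mgraph) : Prop :=
  exists v : G,
    [/\ forall x, ~~ adj v x,
        marking v = unmarked \/ marking v = mu
      & mgraph_iso (delete [set v]) H].

Definition omega1 (G H : mgraph) : Prop :=
  omega1_remove G H \/ omega1_remove H G.

Definition same_outer_neighbors (G : mgraph) (v w : G) : Prop :=
  forall x, x \notin [set v; w] -> adj v x = adj w x.

Definition omega2a (G H : mgraph) : Prop :=
  exists v w : G,
    [/\ looped v, ~~ looped w,
        marking v = unmarked /\ marking w = unmarked,
        same_outer_neighbors v w
      & mgraph_iso (delete [set v; w]) H].

Definition omega2b (G H : mgraph) : Prop :=
  exists v w z : G,
    [/\ looped v /\ ~~ looped w,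
        marking v = mc /\ marking w = unmarked,
        forall x, adj w x = (x == v),
        z \notin [set v; w] /\ adj v z
      & mgraph_iso (@delete (pivot v z) [set v; w]) H].

(* The vertices v and w are required to be adjacent.  The bracket is not
   invariant under the same replacement for non-adjacent v and w: on the path
   v - z - w with v looped and marked c, and z and w unlooped and unmarked, the
   reduced bracket is 2A + A^-1 - A^-5 before and A + A^-1 after. *)
Definition omega2c (G H : mgraph) : Prop :=
  exists v w z : G,
    [/\ looped v /\ ~~ looped w,
        marking v = mc /\ marking w = unmarked,
        adj v w /\ same_outer_neighbors v w,
        z \notin [set v; w] /\ (adj v z /\ adj w z)
      & mgraph_iso (@delete (pivot v z) [set v; w]) H].

Definition omega2d (G H : mgraph) : Prop :=
  exists v w : G,
    [/\ looped v /\ ~~ looped w,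
        marking v = mc /\ marking w = unmarked,
        forall x, adj w x = (x == v),
        forall x, adj v x = (x == w)
      & mgraph_iso (@delete (add_free_loop G) [set v; w]) H].

Definition omega2_reduce (G H : mgraph) : Prop :=
  [\/ omega2a G H, omega2b G H, omega2c G H | omega2d G H].

Definition omega2 (G H : mgraph) : Prop :=
  omega2_reduce G H \/ omega2_reduce H G.

Definition omega3_basic (G H : mgraph) : Prop :=
  exists u v w : G,
    [/\ [/\ marking u = unmarked, marking v = unmarked
          & marking w = unmarked],
        [/\ adj u v, adj u w & adj v w],
        [/\ looped u, ~~ looped v & ~~ looped w],
        forall x, x \notin [set u; v; w] ->
          (adj x u + adj x v + adj x w = 0)%N \/
          (adj x u + adj x v + adj x w = 2)%N
      & mgraph_iso (cut_edges [set u; v; w]) H].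

Inductive omega3 : mgraph -> mgraph -> Prop :=
| Omega3_basic G H : omega3_basic G H -> omega3 G H
| Omega3_inverse G H : omega3 H G -> omega3 G H
| Omega3_comp_left G H K : omega2 G H -> omega3 H K -> omega3 G K
| Omega3_comp_right G H K : omega3 G H -> omega2 H K -> omega3 G K
| Omega3_mirror G H : omega3 (mirror G) (mirror H) -> omega3 G H.

Inductive lc_sequence : mgraph -> mgraph -> Prop :=
| Lc_nil (G : mgraph) : lc_sequence G G
| Lc_cons (G : mgraph) (v : G) (H : mgraph) : lc_sequence (lc v) H -> lc_sequence G H.

Definition marked_graph_move (move : mgraph -> mgraph -> Prop)
    (G H : mgraph) : Prop :=
  exists G' H', [/\ lc_sequence G G', move G' H' & lc_sequence H' H].

Section Bracket.

Variable G : mgraph.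

Definition adjmx : 'M['F_2]_#|G| :=
  \matrix_(i, j)
    (if i == j then looped (enum_val i)
     else adj (enum_val i) (enum_val j))%:R.

Definition deltamx (T : {set G}) : 'M['F_2]_#|G| :=
  \matrix_(i, j)
    ((i == j) &&
     ((enum_val i \in T) (+) involves_r (marking (enum_val i))))%:R.

Definition kept (T : {set G}) : {set 'I_#|G|} :=
  [set i | let d := (adjmx + deltamx T) i i in
     ~~ (is_c_or_cr (marking (enum_val i)) && (d == 0)) &&
     ~~ (is_u_or_ur (marking (enum_val i)) && (d == 1))].

Definition adjmx_sub (T : {set G}) : 'M['F_2]_#|kept T| :=
  mxsub (@enum_val _ (mem (kept T))) (@enum_val _ (mem (kept T)))
    (adjmx + deltamx T).

(* [kermx] is the left kernel, of the same dimension for a square matrix. *)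
Definition nullity (n : nat) (M : 'M['F_2]_n) : nat := \rank (kermx M).

Definition brA : {mpoly int[3]} := 'X_(@inord 2 0).
Definition brB : {mpoly int[3]} := 'X_(@inord 2 1).
Definition brd : {mpoly int[3]} := 'X_(@inord 2 2).

Definition bracket : {mpoly int[3]} :=
  brd ^+ free_loops G *
  \sum_(T : {set G})
    brA ^+ (#|G| - #|T|) * brB ^+ #|T| * brd ^+ nullity (adjmx_sub T).

(* A |-> A, B |-> A^-1, d |-> - A^-2 - A^2, where A is [lX]. *)
Definition reduction (i : 'I_3) : laurent :=
  [:: lX; lX^-1; - lX ^- 2 - lX ^+ 2]`_i.

Definition reduced_bracket : laurent := mmap intr reduction bracket.

Definition n_looped : nat := #|[set v : G | looped v]|.

(* An element of Z[t^(1/4), t^(-1/4)]: here [lX] is t^(1/4). *)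
Definition jones : laurent :=
  (-1) ^+ #|G| * lX ^ (3 * #|G|%:Z - 6 * n_looped%:Z)
  * leval reduced_bracket (lX^-1).

End Bracket.

(* Main.v *)
(** The nullity of A(G)_T is the dimension of the space of those GF(2)-vectors
    x on V(G) which satisfy one linear condition at each vertex v, on the pair
    (x v, y v) with y = A x (loops not counted in A): x v = 0 if v is removed,
    and y v + d (x v) = 0 if v is kept with diagonal entry d.  The three
    conditions are the three lines of GF(2)^2, and a marked local complement at
    v is the change of variable x v := x v + y v, which permutes the lines
    exactly as the marks prescribe; so each term of the state sum is invariant.

    The other moves are local: adding to x a multiple of the indicator of the
    two or three vertices involved (possibly depending linearly on x)
    compares the solution spaces of the different states, and the reduced
    bracket relation d = - A^2 - A^-2 finishes.  For Omega.2 (b) and (c) the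
    pivot turns the two vertices into the ones of a move (a).  Everything is
    done for an arbitrary unit a in place of A, since taking the mirror image
    replaces a by a^-1. *)
Require Import Defs.
From mathcomp Require Import all_boot all_order all_algebra.
From mathcomp Require Import fraction mxabelem mpoly ring zify.

Set Implicit Arguments.
Unset Strict Implicit.
Unset Printing Implicit Defensive.

Import GRing.Theory.

(** * Linear systems over GF(2) with one condition per vertex *)

Section Systems.

Variable V : finType.
Implicit Types (e : rel V) (c : V -> option bool) (x : {ffun V -> bool}).

Definition row_sum e x v : bool := \big[addb/false]_w (e v w && x w).

(* [None]: the vertex is removed from the matrix; [Some d]: it is kept, with
   diagonal entry d. *)
Definition row_ok (s : option bool) (xv yv : bool) : bool :=
  if s is Some d then ~~ (yv (+) (d && xv)) else ~~ xv.

Definition solution e c x : bool :=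
  [forall v, row_ok (c v) (x v) (row_sum e x v)].

Definition n_solutions e c : nat := #|[set x | solution e c x]|.

(* The solutions form a vector space over GF(2), so this is its dimension. *)
Definition corank e c : nat := logn 2 (n_solutions e c).

Definition shift (U : {set V}) (k : bool) x : {ffun V -> bool} :=
  [ffun v => x v (+) ((v \in U) && k)].

Lemma shift_row_sum e U k x v :
  row_sum e (shift U k x) v = row_sum e x v (+) (k && \big[addb/false]_(w in U) e v w).
Proof.
rewrite /row_sum (big_mkcond (mem U)) big_distrr -big_split /=.
apply: eq_bigr => w _; rewrite ffunE.
by case: (e v w); case: (x w); case: (w \in U); case: k.
Qed.

Lemma shiftK U k x : shift U k (shift U k x) = x.
Proof. by apply/ffunP => v; rewrite !ffunE -addbA addbb addbF. Qed.

Lemma eq_n_solutions e c e' c' : e =2 e' -> c =1 c' ->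
  n_solutions e c = n_solutions e' c'.
Proof.
move=> ee ec; apply: eq_card => x; rewrite !inE; apply: eq_forallb => v.
by rewrite ec; congr row_ok; apply: eq_bigr => w _; rewrite ee.
Qed.

Lemma n_solutions_inv e c e' c' (f : {ffun V -> bool} -> {ffun V -> bool}) :
    involutive f -> (forall x, solution e' c' (f x) = solution e c x) ->
  n_solutions e c = n_solutions e' c'.
Proof.
move=> fK ef; rewrite /n_solutions -[RHS](card_preimset _ (inv_inj fK)).
by apply: eq_card => x; rewrite !inE ef.
Qed.

Lemma n_solutions_gt0 e c : (0 < n_solutions e c)%N.
Proof.
apply/card_gt0P; exists [ffun => false]; rewrite inE; apply/forallP => v.
rewrite /row_sum big1 ?ffunE => [|w _]; last by rewrite ffunE andbF.
by case: (c v) => [[]|].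
Qed.

(** The involution [f] exchanges the solutions with [x v] true and those with [x v] false. The
    latter are the solutions of the second system, so the count doubles. *)
Lemma corank_double e c e' c' (f : {ffun V -> bool} -> {ffun V -> bool}) v :
    involutive f -> (forall x, f x v = ~~ x v) ->
    (forall x, solution e c (f x) = solution e c x) ->
    (forall x, solution e' c' x = solution e c x && ~~ x v) ->
  corank e c = (corank e' c').+1.
Proof.
move=> fK fv fs s'; rewrite /corank.
suff -> : n_solutions e c = (2 * n_solutions e' c')%N.
  by rewrite lognM ?n_solutions_gt0.
rewrite /n_solutions -(cardsID [set x : {ffun V -> bool} | x v]) mul2n -addnn.
congr (_ + _)%N; last by apply: eq_card => x; rewrite !inE s' andbC.
rewrite -(card_preimset _ (inv_inj fK)).
by apply: eq_card => x; rewrite !inE s' fs fv.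
Qed.

Lemma solutionE e c x (U : {set V}) : solution e c x =
  [forall (v | v \in U), row_ok (c v) (x v) (row_sum e x v)] &&
  [forall (v | v \notin U), row_ok (c v) (x v) (row_sum e x v)].
Proof.
apply/forallP/andP => [s | [/'forall_implyP s1 /'forall_implyP s2] v].
  by split; apply/'forall_implyP.
by case: (boolP (v \in U)) => [/s1 | /s2].
Qed.

Lemma forall_in2 (P : pred V) v w :
  [forall (y | y \in [set v; w]), P y] = P v && P w.
Proof.
apply/'forall_implyP/andP => [h | [Pv Pw] y].
  by split; apply: h; rewrite !inE eqxx ?orbT.
by rewrite !inE => /orP[] /eqP->.
Qed.

Lemma forall_in3 (P : pred V) u v w :
  [forall (y | y \in [set u; v; w]), P y] = [&& P u, P v & P w].
Proof.
apply/'forall_implyP/and3P => [h | [Pu Pv Pw] y].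
  by split; apply: h; rewrite !inE eqxx ?orbT.
by rewrite !inE -orbA => /or3P[] /eqP->.
Qed.

Lemma forall_in1 (P : pred V) v : [forall (y | y \in [set v]), P y] = P v.
Proof.
apply/'forall_implyP/idP => [h | Pv y]; first by apply: h; rewrite inE.
by rewrite inE => /eqP->.
Qed.

Lemma sum_in2 (P : pred V) v w : v != w ->
  \big[addb/false]_(y in [set v; w]) P y = P v (+) P w.
Proof. by move=> vw; rewrite big_setU1 ?inE //= big_set1. Qed.

Lemma sum_in3 (P : pred V) u v w : u != v -> u != w -> v != w ->
  \big[addb/false]_(y in [set u; v; w]) P y = P u (+) P v (+) P w.
Proof.
move=> uv uw vw; rewrite -setUA big_setU1 ?inE ?negb_or ?uv //=.
by rewrite sum_in2 // addbA.
Qed.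

End Systems.

(** * Two vertices with the same outer neighbors *)

Section Twins.

Variables (V : finType) (e : rel V) (v w : V).
Hypotheses (e_sym : ssrbool.symmetric e) (e_irr : irreflexive e) (vw : v != w).
Hypothesis twins : forall y, y \notin [set v; w] -> e v y = e w y.

Let U := [set v; w].

(** Over GF(2) the sum of the rows of [v] and [w] vanishes outside [U], and on [U] both of its
    entries are [e v w]. *)
Lemma twins_row_sum x : row_sum e x w = row_sum e x v (+) (e v w && (x v (+) x w)).
Proof.
rewrite -[LHS](addKb (row_sum e x v)); congr (_ (+) _).
have -> : row_sum e x v (+) row_sum e x w =
    \big[addb/false]_(y in U) ((e v y (+) e w y) && x y).
  rewrite /row_sum -big_split [RHS]big_mkcond /=; apply: eq_bigr => y _.
  rewrite -andb_addl; case: ifPn => // /twins ->.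
  by rewrite addbb.
rewrite sum_in2 // !e_irr (e_sym w) addbF addFb.
by case: (e v w); rewrite ?addbF.
Qed.

Lemma shift_twins_row_sum k x y :
  row_sum e (shift U k x) y = row_sum e x y (+) (k && (y \in U) && e v w).
Proof.
rewrite shift_row_sum sum_in2 // -andbA; congr (_ (+) (_ && _)).
rewrite !inE; case: (eqVneq y v) => [->|yv]; first by rewrite e_irr.
case: (eqVneq y w) => [->|yw] /=; first by rewrite e_irr e_sym addbF.
by rewrite !(e_sym y) twins ?addbb // !inE negb_or yv.
Qed.

Lemma solution_with2 c p q x : solution e [eta c with v |-> p, w |-> q] x =
  row_ok p (x v) (row_sum e x v) && row_ok q (x w) (row_sum e x w) &&
  [forall (y | y \notin U), row_ok (c y) (x y) (row_sum e x y)].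
Proof.
rewrite (solutionE _ _ _ U) forall_in2 /= !eqxx eq_sym (negbTE vw).
congr (_ && _); apply: eq_forallb => y.
by rewrite !inE; case: eqP => //; case: eqP.
Qed.

Lemma shift_twins_rest c k x :
  [forall (y | y \notin U), row_ok (c y) (shift U k x y) (row_sum e (shift U k x) y)]
  = [forall (y | y \notin U), row_ok (c y) (x y) (row_sum e x y)].
Proof.
apply: eq_forallb => y; rewrite shift_twins_row_sum ffunE.
by case: (y \in U) => //=; rewrite !andbF !addbF.
Qed.

(** The transposition of [v] and [w] is an automorphism of [e]. On vectors it is the shift of [U] by
    [x v (+) x w], which exchanges the two values. *)
Lemma twins_swap c :
  corank e [eta c with v |-> Some (~~ e v w), w |-> Some (e v w)] =
  corank e [eta c with v |-> Some (e v w), w |-> Some (~~ e v w)].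
Proof.
congr logn.
apply: (n_solutions_inv (f := fun x => shift U (x v (+) x w) x)) => x.
  rewrite -[RHS](shiftK U (x v (+) x w)); congr shift.
  rewrite !ffunE !inE !eqxx orbT /=.
  by case: (x v); case: (x w).
rewrite !solution_with2 shift_twins_rest; congr (_ && _).
rewrite !shift_twins_row_sum !ffunE !inE !eqxx orbT /= twins_row_sum.
by case: (row_sum e x v); case: (x v); case: (x w); case: (e v w).
Qed.

(** With both diagonal entries equal to [e v w] the rows of [v] and [w] coincide and the indicator
    of [U] lies in the kernel. Flipping the entry at [w] adds the equation x w = 0. *)
Lemma twins_double c :
  corank e [eta c with v |-> Some (e v w), w |-> Some (e v w)] =
  (corank e [eta c with v |-> Some (e v w), w |-> Some (~~ e v w)]).+1.
Proof.
apply: (corank_double (f := shift U true) (v := w)) => x; first exact: shiftK.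
- by rewrite ffunE !inE eqxx orbT addbT.
- rewrite !solution_with2 shift_twins_rest; congr (_ && _).
  rewrite !shift_twins_row_sum !ffunE !inE !eqxx orbT /= twins_row_sum.
  by case: (row_sum e x v); case: (x v); case: (x w); case: (e v w).
rewrite !solution_with2 [RHS]andbAC; congr (_ && _).
rewrite /= twins_row_sum.
by case: (row_sum e x v); case: (x v); case: (x w); case: (e v w).
Qed.

Lemma twins_delete c :
  corank e [eta c with v |-> Some (~~ e v w), w |-> Some (~~ e v w)] =
  corank e [eta c with v |-> None, w |-> None].
Proof.
(* For a solution of the first system x v = x w, and [k x] is this common value, so the shift clears
   both. Since [k] is unchanged by the shift, the map is an involution. *)
congr logn; pose k x := row_sum e x v (+) (e v w && x w).
apply: (n_solutions_inv (f := fun x => shift U (k x) x)) => x.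
  rewrite -[RHS](shiftK U (k x)); congr shift.
  rewrite {1}/k shift_twins_row_sum ffunE !inE !eqxx orbT /= /k.
  by case: (row_sum e x v); case: (x w); case: (e v w).
rewrite !solution_with2 shift_twins_rest; congr (_ && _).
rewrite !ffunE !inE !eqxx orbT /= twins_row_sum /k.
by case: (row_sum e x v); case: (x v); case: (x w); case: (e v w).
Qed.

End Twins.

(** * An isolated vertex *)

Section Isolated.

Variables (V : finType) (e : rel V) (v : V).
Hypotheses (e_sym : ssrbool.symmetric e) (isolated : forall y, ~~ e v y).

Lemma isolated_row_sum x : row_sum e x v = false.
Proof. by apply: big1 => y _; rewrite (negbTE (isolated y)). Qed.

Lemma shift_isolated_row_sum k x y :
  row_sum e (shift [set v] k x) y = row_sum e x y.
Proof. by rewrite shift_row_sum big_set1 e_sym (negbTE (isolated y)) andbF addbF. Qed.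

Lemma solution_with1 c p x : solution e [eta c with v |-> p] x =
  row_ok p (x v) (row_sum e x v) &&
  [forall (y | y \notin [set v]), row_ok (c y) (x y) (row_sum e x y)].
Proof.
rewrite (solutionE _ _ _ [set v]) forall_in1 /= !eqxx.
congr (_ && _); apply: eq_forallb => y.
by rewrite !inE; case: eqP.
Qed.

(** The row of [v] is zero, so a kept [v] with diagonal entry 0 imposes no condition and x v is
    free. *)
Lemma isolated_double c :
  corank e [eta c with v |-> Some false] = (corank e [eta c with v |-> None]).+1.
Proof.
apply: (corank_double (f := shift [set v] true) (v := v)) => x; first exact: shiftK.
- by rewrite ffunE !inE eqxx addbT.
- rewrite !solution_with1 /= !isolated_row_sum; apply: eq_forallb => y.
  by rewrite shift_isolated_row_sum ffunE; case: (y \in _); rewrite /= ?addbF.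
by rewrite !solution_with1 /= !isolated_row_sum andbC.
Qed.

Lemma isolated_delete c :
  corank e [eta c with v |-> Some true] = corank e [eta c with v |-> None].
Proof.
congr logn; apply: eq_card => x; rewrite !inE.
by rewrite !solution_with1 /= !isolated_row_sum.
Qed.

End Isolated.

(** * A component consisting of a single edge *)

Section IsolatedEdge.

Variables (V : finType) (e : rel V) (v w : V).
Hypotheses (e_sym : ssrbool.symmetric e) (vw : v != w).
Hypotheses (nbr_v : forall y, e v y = (y == w)) (nbr_w : forall y, e w y = (y == v)).

Lemma edge_row_sum_l x : row_sum e x v = x w.
Proof.
rewrite /row_sum (bigD1 w) //= nbr_v eqxx big1 ?addbF // => y.
by rewrite nbr_v => /negbTE->.
Qed.

Lemma edge_row_sum_r x : row_sum e x w = x v.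
Proof.
rewrite /row_sum (bigD1 v) //= nbr_w eqxx big1 ?addbF // => y.
by rewrite nbr_w => /negbTE->.
Qed.

Lemma edge_delete c p q :
    (forall a b, row_ok p a b && row_ok q b a = ~~ a && ~~ b) ->
  corank e [eta c with v |-> p, w |-> q] = corank e [eta c with v |-> None, w |-> None].
Proof.
move=> pq; congr logn; apply: eq_card => x; rewrite !inE.
by rewrite !solution_with2 // edge_row_sum_l edge_row_sum_r pq.
Qed.

(** With a = x v and b = x w, the row sums at [v] and [w] are b and a. The hypotheses say that the
    pairs (a, b) allowed by the two conditions form the line spanned by (d, 1). *)
Lemma edge_double c p q d :
    (forall a b, row_ok p a b && row_ok q b a =
      row_ok p (a (+) d) (~~ b) && row_ok q (~~ b) (a (+) d)) ->
    (forall a b, row_ok p a b && row_ok q b a && ~~ b = ~~ a && ~~ b) ->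
  corank e [eta c with v |-> p, w |-> q] =
  (corank e [eta c with v |-> None, w |-> None]).+1.
Proof.
(* [U] is the support of the spanning vector (d, 1). *)
move=> pqd pq0; pose U := if d then [set v; w] else [set w].
have wU : w \in U by rewrite /U; case: d {pqd U}; rewrite !inE eqxx ?orbT.
have vU : (v \in U) = d.
  by rewrite /U; case: d {pqd U wU}; rewrite !inE ?eqxx ?(negbTE vw).
have yU y : y \notin [set v; w] -> y \notin U.
  by apply: contra; rewrite /U; case: d {pqd U wU vU}; rewrite !inE // => ->; rewrite orbT.
apply: (corank_double (f := shift U true) (v := w)) => x; first exact: shiftK.
- by rewrite ffunE wU addbT.
- rewrite !solution_with2 // !edge_row_sum_l !edge_row_sum_r !ffunE wU vU.
  rewrite !andbT addbT -pqd; congr (_ && _).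
  apply: eq_forallb => y; case: (boolP (y \in [set v; w])) => //= yvw.
  rewrite ffunE (negbTE (yU y yvw)) addbF shift_row_sum big1 ?andbF ?addbF // => z.
  have : z \in U -> z \in [set v; w].
    by rewrite /U; case: d {pqd U wU vU yU}; rewrite !inE // => ->; rewrite orbT.
  move=> zU /zU; rewrite e_sym !inE.
  move: yvw; rewrite !inE negb_or => /andP[/negbTE yv /negbTE yw].
  by case/orP => /eqP->; rewrite ?nbr_v ?nbr_w ?yv ?yw.
by rewrite !solution_with2 // edge_row_sum_l edge_row_sum_r [RHS]andbAC pq0.
Qed.

End IsolatedEdge.

(** * Three vertices, an even number of them adjacent to each outer vertex *)

Section Triangle.

Variables (V : finType) (e : rel V) (u v w : V).
Hypotheses (e_sym : ssrbool.symmetric e) (uv : u != v) (uw : u != w) (vw : v != w).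

Let U := [set u; v; w].

Hypothesis even_outside : forall y, y \notin U -> e y u (+) e y v (+) e y w = false.

(** Both sides of an Omega.3 move in one family: the three inner edges are all present for [t] true
    and all absent for [t] false. *)
Definition triangle (t : bool) : rel V :=
  fun x y => if (x \in U) && (y \in U) then t && (x != y) else e x y.

Lemma triangle_row_sum_out t x y :
  y \notin U -> row_sum (triangle t) x y = row_sum (triangle false) x y.
Proof.
by move=> yU; apply: eq_bigr => z _; rewrite /triangle (negbTE yU).
Qed.

Lemma triangle_row_sum_in t x y : y \in U -> row_sum (triangle t) x y =
  row_sum (triangle false) x y (+) (t && \big[addb/false]_(z in U) ((y != z) && x z)).
Proof.
move=> yU; rewrite big_distrr [X in _ (+) X]big_mkcond -big_split /=.
apply: eq_bigr => z _; rewrite /triangle yU /=.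
by case: (z \in U); rewrite ?addbF // addFb andbA.
Qed.

(** By parity, the rows of the three vertices add up to zero once the inner edges are removed. *)
Lemma triangle_row_sum x :
  row_sum (triangle false) x w =
  row_sum (triangle false) x u (+) row_sum (triangle false) x v.
Proof.
rewrite -[LHS](addKb (row_sum (triangle false) x u (+) row_sum (triangle false) x v)).
rewrite -[RHS]addbF; congr (_ (+) _).
rewrite /row_sum -!big_split big1 //= => y _; rewrite /triangle !inE !eqxx !orbT /=.
rewrite -!andb_addl; case: ifPn => [_|yU] //.
by rewrite !(e_sym _ y) even_outside ?inE.
Qed.

Lemma shift_triangle_row_sum k x y :
  row_sum (triangle false) (shift U k x) y = row_sum (triangle false) x y.
Proof.
rewrite shift_row_sum sum_in3 // /triangle !inE !eqxx !orbT !andbT.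
case: ifPn => [|yU]; first by rewrite andbF addbF.
by rewrite even_outside ?andbF ?addbF // !inE.
Qed.

(** Here a, b, c are the values at [u], [v], [w], and P, Q, P + Q are their row sums without inner
    edges. If all three are kept with diagonal entries p, q, r, the three equations add up to p a +
    q b + r c = 0. *)
Definition triangle_ok t p q r (a b c P Q : bool) : bool :=
  [&& row_ok p a (P (+) (t && (b (+) c))),
      row_ok q b (Q (+) (t && (a (+) c)))
    & row_ok r c (P (+) Q (+) (t && (a (+) b)))].

Lemma solution_triangle t f p q r x :
  solution (triangle t) [eta f with u |-> p, v |-> q, w |-> r] x =
  triangle_ok t p q r (x u) (x v) (x w)
    (row_sum (triangle false) x u) (row_sum (triangle false) x v) &&
  [forall (y | y \notin U), row_ok (f y) (x y) (row_sum (triangle false) x y)].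
Proof.
rewrite (solutionE _ _ _ U) forall_in3 /= !eqxx !(eq_sym v) !(eq_sym w).
rewrite (negbTE uv) (negbTE uw) (negbTE vw); congr (_ && _).
  rewrite /triangle_ok -triangle_row_sum !(triangle_row_sum_in t) ?inE ?eqxx ?orbT //.
  rewrite !sum_in3 // !eqxx !(eq_sym v) !(eq_sym w) uv uw vw /=.
  by rewrite !addbF.
apply: eq_forallb => y; case: (boolP (y \in U)) => //= yU.
rewrite triangle_row_sum_out //; move: yU; rewrite !inE !negb_or -andbA.
by case/and3P => /negbTE-> /negbTE-> /negbTE->.
Qed.

Lemma shift_triangle_rest f k x :
  [forall (y | y \notin U), row_ok (f y) (shift U k x y)
     (row_sum (triangle false) (shift U k x) y)] =
  [forall (y | y \notin U), row_ok (f y) (x y) (row_sum (triangle false) x y)].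
Proof.
apply: eq_forallb => y; rewrite shift_triangle_row_sum ffunE.
by case: (y \in U); rewrite /= ?addbF.
Qed.

(** Adding the same d to a, b and c preserves P, Q, the differences of a, b, c and all conditions
    outside [U]. Invariance of [k] makes this change of variable an involution. *)
Lemma triangle_eq t t' f p q r p' q' r' (k : bool -> bool -> bool -> bool) :
    (forall a b c d, k (a (+) d) (b (+) d) (c (+) d) = k a b c) ->
    (forall a b c P Q, let d := k a b c in
      triangle_ok t' p' q' r' (a (+) d) (b (+) d) (c (+) d) P Q =
      triangle_ok t p q r a b c P Q) ->
  corank (triangle t) [eta f with u |-> p, v |-> q, w |-> r] =
  corank (triangle t') [eta f with u |-> p', v |-> q', w |-> r'].
Proof.
move=> k_inv ok_inv; congr logn.
have [uU vU wU] : [/\ u \in U, v \in U & w \in U] by rewrite !inE !eqxx !orbT.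
apply: (n_solutions_inv (f := fun x => shift U (k (x u) (x v) (x w)) x)) => x.
  rewrite -[RHS](shiftK U (k (x u) (x v) (x w))); congr shift.
  by rewrite !ffunE uU vU wU k_inv.
rewrite !solution_triangle shift_triangle_rest; congr (_ && _).
by rewrite !shift_triangle_row_sum !ffunE uU vU wU ok_inv.
Qed.


(** The digits in the name are the diagonal entries at [u], [v], [w]. The equations for 100 sum to a
    = 0 and those for 001 to c = 0, and the shift by a + c exchanges a and c. *)
Lemma triangle_100 t f :
  corank (triangle t) [eta f with u |-> Some true, v |-> Some false, w |-> Some false] =
  corank (triangle t) [eta f with u |-> Some false, v |-> Some false, w |-> Some true].
Proof.
by apply: (triangle_eq f (k := fun a b c => a (+) c)); [do 4!case | case: t; do 5!case].
Qed.

Lemma triangle_010 t f :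
  corank (triangle t) [eta f with u |-> Some false, v |-> Some true, w |-> Some false] =
  corank (triangle t) [eta f with u |-> Some false, v |-> Some false, w |-> Some true].
Proof.
by apply: (triangle_eq f (k := fun a b c => b (+) c)); [do 4!case | case: t; do 5!case].
Qed.

(** The equations sum to a + b + c = 0. Replacing the diagonal terms a and b by b + c and a + c in
    the first two equations toggles the inner edges, and the shift by a + b = c clears the value at
    [w]. *)
Lemma triangle_111 t f :
  corank (triangle t) [eta f with u |-> Some true, v |-> Some true, w |-> Some true] =
  corank (triangle (~~ t)) [eta f with u |-> Some false, v |-> Some false, w |-> Some true].
Proof.
by apply: (triangle_eq f (k := fun a b c => a (+) b)); [do 4!case | case: t; do 5!case].
Qed.

(** The third equation is the sum of the other two, and the indicator of [U] is a solution. Changing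
    the last entry to 1 adds the equation c = 0. *)
Lemma triangle_000 t f :
  corank (triangle t) [eta f with u |-> Some false, v |-> Some false, w |-> Some false] =
  (corank (triangle t) [eta f with u |-> Some false, v |-> Some false, w |-> Some true]).+1.
Proof.
have [uU vU wU] : [/\ u \in U, v \in U & w \in U] by rewrite !inE !eqxx !orbT.
apply: (corank_double (f := shift U true) (v := w)) => x; first exact: shiftK.
- by rewrite ffunE wU addbT.
- rewrite !solution_triangle shift_triangle_rest; congr (_ && _).
  rewrite !shift_triangle_row_sum !ffunE uU vU wU /triangle_ok /=.
  by case: (x u); case: (x v); case: (x w).
rewrite !solution_triangle [RHS]andbAC; congr (_ && _); rewrite /triangle_ok /=.
by case: t; case: (x u); case: (x v); case: (x w);
  case: (row_sum _ x u); case: (row_sum _ x v).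
Qed.

(** Here a = b, and the shift exchanges this common value with c. The diagonal terms thereby change
    by b + c, which is exactly the contribution of toggling the inner edges. The cases 101 and 011
    are the same with the vertices permuted. *)
Lemma triangle_110 t f :
  corank (triangle t) [eta f with u |-> Some true, v |-> Some true, w |-> Some false] =
  corank (triangle (~~ t)) [eta f with u |-> Some true, v |-> Some true, w |-> Some false].
Proof.
by apply: (triangle_eq f (k := fun a b c => b (+) c)); [do 4!case | case: t; do 5!case].
Qed.

Lemma triangle_101 t f :
  corank (triangle t) [eta f with u |-> Some true, v |-> Some false, w |-> Some true] =
  corank (triangle (~~ t)) [eta f with u |-> Some true, v |-> Some false, w |-> Some true].
Proof.
by apply: (triangle_eq f (k := fun a b c => b (+) c)); [do 4!case | case: t; do 5!case].
Qed.

Lemma triangle_011 t f :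
  corank (triangle t) [eta f with u |-> Some false, v |-> Some true, w |-> Some true] =
  corank (triangle (~~ t)) [eta f with u |-> Some false, v |-> Some true, w |-> Some true].
Proof.
by apply: (triangle_eq f (k := fun a b c => a (+) c)); [do 4!case | case: t; do 5!case].
Qed.

End Triangle.

(** * The linear system of a state *)

Section States.

Variable G : mgraph.
Implicit Types (S T : {set G}) (v : G).

Definition diagonal T v : bool :=
  looped v (+) (v \in T) (+) involves_r (marking v).

Definition mark_state (m : mark) (d : bool) : option bool :=
  if (is_c_or_cr m && ~~ d) || (is_u_or_ur m && d) then None else Some d.

(** The vertices of [S] count as deleted, so that the states of G - S are compared with those of G
    on one vertex type. *)
Definition state S T v : option bool :=
  if v \in S then None else mark_state (marking v) (diagonal T v).

End States.

(** * Matrix nullity as the dimension of a solution space *)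

Section Matrices.

Local Open Scope ring_scope.

Lemma F2_addb (a b : bool) : (a (+) b)%:R = a%:R + b%:R :> 'F_2.
Proof. by case: a; case: b; apply: val_inj. Qed.

Lemma F2_bool (y : 'F_2) : y = (y != 0)%:R.
Proof. by apply: val_inj; case: y => [[|[|]]]. Qed.

Lemma F2_eq0 (b : bool) : (b%:R == 0 :> 'F_2) = ~~ b.
Proof. by case: b. Qed.

Lemma F2_eq1 (b : bool) : (b%:R == 1 :> 'F_2) = b.
Proof. by case: b. Qed.

Variables (G : mgraph) (T : {set G}).

Let A : 'M['F_2]_#|G| := adjmx G + deltamx T.

Lemma adjmx_deltamxE (k l : 'I_#|G|) : A k l =
  (if k == l then diagonal T (enum_val k) else adj (enum_val k) (enum_val l))%:R.
Proof.
rewrite /A !mxE; case: eqP => [->|_] /=; last by rewrite addr0.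
by rewrite -F2_addb addbA.
Qed.

Lemma kept_state v : state set0 T v =
  if enum_rank v \in kept T then Some (diagonal T v) else None.
Proof.
rewrite /state !inE /mark_state adjmx_deltamxE eqxx enum_rankK F2_eq0 F2_eq1.
by rewrite -negb_or; case: (_ || _).
Qed.

Let ev (i : 'I_#|kept T|) : G := enum_val (enum_val i).

Let rowvec (x : {ffun G -> bool}) : 'rV['F_2]_#|kept T| := \row_i (x (ev i))%:R.

Lemma ev_inj : injective ev.
Proof. by move=> i j /enum_val_inj /enum_val_inj. Qed.

Lemma evP v : reflect (exists i, v = ev i) (enum_rank v \in kept T).
Proof.
apply: (iffP idP) => [kv | [i ->]]; last by rewrite enum_valK enum_valP.
by exists (enum_rank_in kv (enum_rank v)); rewrite /ev enum_rankK_in ?enum_rankK.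
Qed.

(** Since [x] vanishes at the removed vertices, the sum over the kept indices extends to all
    vertices. Symmetry of the adjacency turns the column sum into a row sum. *)
Lemma rowvec_mul (x : {ffun G -> bool}) j : (forall v, enum_rank v \notin kept T -> ~~ x v) ->
  (rowvec x *m adjmx_sub T) 0 j =
  (row_sum adj x (ev j) (+) (diagonal T (ev j) && x (ev j)))%:R.
Proof.
move=> x0; rewrite mxE.
pose F (k : 'I_#|G|) : 'F_2 := (x (enum_val k))%:R * A k (enum_val j).
rewrite (eq_bigr (fun i => F (enum_val i))) => [|i _]; last first.
  by rewrite [rowvec x _ _]mxE [adjmx_sub T _ _]mxE.
rewrite -(big_enum_val (A := mem (kept T)) F) big_mkcond /=.
rewrite (eq_bigr F) => [|k _]; last first.
  case: ifPn => // kk; rewrite /F; have := x0 (enum_val k); rewrite enum_valK.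
  by move=> /(_ kk)/negbTE->; rewrite mul0r.
rewrite (reindex (@enum_rank G)) /=; last exact/onW_bij/enum_rank_bij.
pose w := ev j; rewrite -/w.
rewrite (eq_bigr (fun v => ((adj w v && x v) (+) ((v == w) && (diagonal T w && x w)))%:R)).
  rewrite -(big_morph _ F2_addb (erefl : (false%:R = 0 :> 'F_2))) big_split /=.
  congr (_ (+) _)%:R; rewrite (bigD1 w) //= eqxx big1 ?addbF // => v.
  by move/negbTE->.
move=> v _; rewrite /F adjmx_deltamxE enum_rankK -/(ev j) -/w.
rewrite -[enum_val j]enum_valK (inj_eq enum_rank_inj) -/(ev j) -/w -natrM mulnb.
congr _%:R; rewrite adj_sym; case: eqP => [->|_]; last by rewrite addbF andbC.
by rewrite adj_irr andbC.
Qed.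

Lemma nullity_corank : nullity (adjmx_sub T) = corank adj (state set0 T).
Proof.
rewrite /nullity /corank; set k := \rank _.
suff -> : n_solutions adj (state set0 T) = (2 ^ k)%N by rewrite pfactorK.
have sol0 x : solution adj (state set0 T) x ->
    forall v, enum_rank v \notin kept T -> ~~ x v.
  by move=> /forallP s v /negbTE kv; have := s v; rewrite kept_state kv.
have solE (x : {ffun G -> bool}) : (forall v, enum_rank v \notin kept T -> ~~ x v) ->
    solution adj (state set0 T) x = (rowvec x *m adjmx_sub T == 0).
  move=> x0; apply/forallP/eqP => [s | /rowP m0 v].
    apply/rowP => j; rewrite rowvec_mul // [RHS]mxE; apply/eqP; rewrite F2_eq0.
    have := s (ev j); rewrite kept_state (introT (evP _)) //; by exists j.
  rewrite kept_state; case: ifPn => [/evP[j ->] | /x0 //].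
  by have /eqP := m0 j; rewrite rowvec_mul // [X in _ == X]mxE F2_eq0.
(* The left kernel has 2 ^ k elements, and [rowvec] maps the solutions bijectively onto it. *)
have -> : (2 ^ k)%N = #|rowg (kermx (adjmx_sub T))| by rewrite card_rowg card_Fp.
rewrite /n_solutions -(card_in_imset (f := rowvec)) => [|x y].
  apply: eq_card => r; rewrite mem_rowg sub_kermx; apply/imsetP/idP => [[x] | r0].
    by rewrite inE => s ->; rewrite -solE //; apply: sol0.
  pose x := [ffun v => [exists i, (v == ev i) && (r 0 i != 0)]].
  have xr : r = rowvec x.
    apply/rowP => i; rewrite mxE ffunE [LHS]F2_bool; congr (nat_of_bool _)%:R.
    apply/idP/existsP => [ri | [i' /andP[/eqP/ev_inj->]]] //.
    by exists i; rewrite eqxx.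
  exists x => //; rewrite inE solE -?xr // => v vk.
  rewrite ffunE negb_exists; apply/forallP => i.
  by apply: contra vk => /andP[/eqP-> _]; apply/evP; exists i.
rewrite !inE => /sol0 x0 /sol0 y0 exy; apply/ffunP => v.
case: (boolP (enum_rank v \in kept T)) => [/evP[i ->] | vk].
  have /rowP/(_ i) := exy; rewrite !mxE => /eqP.
  by case: (x _); case: (y _).
by rewrite (negbTE (x0 v vk)) (negbTE (y0 v vk)).
Qed.

End Matrices.

(** * Induced marked subgraphs *)

Section Embedding.

Variables (H G : mgraph) (g : H -> G).
Hypotheses (g_inj : injective g) (g_adj : forall x y, adj (g x) (g y) = adj x y).
Hypothesis g_looped : forall x, looped (g x) = looped x.
Hypothesis g_marking : forall x, marking (g x) = marking x.

Let D : {set G} := [set g x | x : H].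

Let extend (x : {ffun H -> bool}) : {ffun G -> bool} :=
  [ffun v => [exists h, (v == g h) && x h]].

Lemma extendE x h : extend x (g h) = x h.
Proof.
rewrite ffunE; apply/existsP/idP => [[h' /andP[/eqP/g_inj->]] // | xh].
by exists h; rewrite eqxx.
Qed.

Lemma extend_out x v : v \notin D -> extend x v = false.
Proof.
move=> vD; rewrite ffunE; apply/existsP => -[h /andP[/eqP vh _]].
by case/imsetP: vD; exists h.
Qed.

Lemma extend_row_sum x h : row_sum adj (extend x) (g h) = row_sum adj x h.
Proof.
rewrite /row_sum (bigID (mem D)) /= [X in _ (+) X]big1 ?addbF => [|v vD].
  rewrite big_imset /=; last by move=> ? ? _ _; apply: g_inj.
  by apply: eq_big => h' // _; rewrite extendE g_adj.
by rewrite extend_out ?andbF.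
Qed.

(** Extension by zero identifies the solutions on [H] with those on [G] in which all vertices
    outside the image are deleted. *)
Lemma embed_corank (T : {set H}) :
  corank adj (state (~: D) (g @: T)) = corank adj (state set0 T).
Proof.
congr logn; rewrite /n_solutions -[RHS](card_imset (f := extend)); last first.
  by move=> x y exy; apply/ffunP => h; rewrite -!extendE exy.
have gD h : g h \in D by apply: imset_f.
have gst h : state (~: D) (g @: T) (g h) = state set0 T h.
  by rewrite /state !inE gD /= g_marking /diagonal g_looped mem_imset // g_marking.
have sol x : solution adj (state (~: D) (g @: T)) (extend x) =
    solution adj (state set0 T) x.
  apply/forallP/forallP => s => [h | v].
    by have := s (g h); rewrite gst extendE extend_row_sum.
  case: (boolP (v \in D)) => [/imsetP[h _ ->] | vD].
    by rewrite gst extendE extend_row_sum.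
  by rewrite /state inE vD /= extend_out.
apply: eq_card => y; rewrite inE; apply/idP/imsetP => [s | [x]]; last first.
  by rewrite inE => sx ->; rewrite sol.
have ey : y = extend [ffun h => y (g h)].
  apply/ffunP => v; case: (boolP (v \in D)) => [/imsetP[h _ ->] | vD].
    by rewrite extendE ffunE.
  rewrite extend_out //; apply: negbTE.
  by have := forallP s v; rewrite /state inE vD.
by exists [ffun h => y (g h)] => //; rewrite inE -sol -ey.
Qed.

End Embedding.

(** * Marked local complementation *)

Lemma lc_corank (G : mgraph) (v : G) (T : {set G}) :
  corank (@adj (lc v)) (state (set0 : {set lc v}) (T : {set lc v})) =
  corank adj (state set0 T).
Proof.
congr logn; symmetry.
(* The row sum at [v] does not involve x v, so adding it to x v is an involution. *)
have rowv x : row_sum adj (shift [set v] (row_sum adj x v) x) v = row_sum adj x v.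
  by rewrite shift_row_sum big_set1 adj_irr andbF addbF.
apply: (n_solutions_inv (f := fun x => shift [set v] (row_sum adj x v) x)) => x.
  by rewrite rowv shiftK.
set x' := shift _ _ x; apply: eq_forallb => y.
have -> : row_sum (@adj (lc v)) x' y = row_sum adj x y (+) (adj v y && x y).
  (* At a neighbor y of [v] the toggled edges contribute the sum of x' over the other neighbors of
     [v], that is, the row sum at [v] plus x' y. The first term then cancels against the change of x
     v. *)
  have -> : row_sum (@adj (lc v)) x' y = row_sum adj x' y (+)
      (adj v y && (row_sum adj x' v (+) x' y)).
    have -> : x' y = \big[addb/false]_z ((y == z) && x' z).
      by rewrite (bigD1 y) //= eqxx big1 ?addbF // => z; rewrite eq_sym => /negbTE->.
    rewrite /row_sum -big_split big_distrr -big_split /=; apply: eq_bigr => z _.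
    rewrite /lc_adj; case: (eqVneq y z) => [<-|_] /=.
      by rewrite adj_irr /=; case: (adj v y); case: (x' y).
    by case: (adj y z); case: (adj v y); case: (adj v z); case: (x' z).
  rewrite rowv shift_row_sum big_set1 ffunE !inE (adj_sym y).
  case: eqP => [->|_]; first by rewrite adj_irr andbF !addbF.
  by case: (adj v y); case: (row_sum adj x v); case: (row_sum adj x y); case: (x y).
(* What remains is one check per mark: at [v] the pair (value, row sum) goes from (p, q) to (p + q,
   q), and at a neighbor from (p, q) to (p, q + p). *)
rewrite /state !inE /diagonal /= /lc_marking ffunE inE.
case: eqP => [->|_] /=.
  rewrite adj_irr /=; case: (marking v) => /=;
  by case: (looped v); case: (v \in T); case: (row_sum adj x v); case: (x v).
rewrite addbF; case: (adj v y); rewrite /= ?addbF //.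
case: (marking y) => /=;
  by case: (looped y); case: (y \in T); case: (row_sum adj x y); case: (x y).
Qed.

(** * State sums at an arbitrary unit *)

Section StateSums.

Local Open Scope ring_scope.

Variables (R : comUnitRingType) (a : R).
Hypothesis a_unit : a \is a GRing.unit.
Implicit Types (G H : mgraph).

Definition loop_value : R := - a^-1 ^+ 2 - a ^+ 2.

(** With B = a^-1 and n the number of vertices of G - S, the monomial A^(n-|T|) B^|T| becomes
    a^(n-2|T|), with an integer exponent. *)
Definition weight G (S T : {set G}) : R :=
  a ^ (#|G|%:Z - #|S|%:Z - #|T|%:Z *+ 2).

Definition state_sum G (S : {set G}) : R :=
  \sum_(T : {set G} | [disjoint T & S])
    weight S T * loop_value ^+ corank adj (state S T).

Definition bracket_at G : R := loop_value ^+ free_loops G * state_sum (set0 : {set G}).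

Lemma weightU1 G (S T : {set G}) v : v \notin T ->
  weight S (v |: T) = weight S T * a^-1 ^+ 2.
Proof.
move=> vT; rewrite /weight cardsU1 vT.
have -> : #|G|%:Z - #|S|%:Z - (true + #|T|)%N%:Z *+ 2 =
    (#|G|%:Z - #|S|%:Z - #|T|%:Z *+ 2) + - 2%:Z by lia.
by rewrite exprzDr // -exprz_inv.
Qed.

Lemma weight0 G (S T : {set G}) : weight set0 T = weight S T * a ^+ #|S|.
Proof.
rewrite /weight cards0.
have -> : #|G|%:Z - 0%N%:Z - #|T|%:Z *+ 2 =
    (#|G|%:Z - #|S|%:Z - #|T|%:Z *+ 2) + #|S|%:Z by lia.
by rewrite exprzDr.
Qed.

Lemma sum_peel (V : finType) (M : zmodType) (P : pred {set V}) (F : {set V} -> M) v :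
    (forall T, P (v |: T) = P T) ->
  \sum_(T | P T) F T = \sum_(T | P T && (v \notin T)) (F T + F (v |: T)).
Proof.
move=> Pv; rewrite big_split /= (bigID (fun T : {set V} => v \notin T)) /=.
congr (_ + _); rewrite (reindex_onto (fun T => v |: T) (fun T => T :\ v)) /=.
  apply: eq_bigl => T; rewrite Pv !inE eqxx /=; case: (P T) => //=.
  apply/eqP/idP => [<- | vT]; first by rewrite !inE eqxx.
  by rewrite setU1K.
by move=> T /andP[_ /negPn vT]; rewrite setD1K.
Qed.

(** Serves isomorphisms, where the complement of the image is empty, and deletions, where it is the
    deleted set. *)
Lemma embed_state_sum G H (g : H -> G) :
    injective g -> (forall x y, adj (g x) (g y) = adj x y) ->
    (forall x, looped (g x) = looped x) -> (forall x, marking (g x) = marking x) ->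
  state_sum (set0 : {set H}) = state_sum (~: [set g x | x : H]).
Proof.
move=> g_inj g_adj g_loop g_mark; rewrite /state_sum.
rewrite [RHS](reindex_onto (fun T : {set H} => g @: T) (fun T => g @^-1: T)) /=.
  apply: eq_big => T; rewrite -?setI_eq0 ?setI0.
    rewrite eqxx; symmetry; apply/andP; split.
      apply/eqP/setP => y; rewrite !inE; apply/negbTE; rewrite negb_and negbK.
      by case: (boolP (y \in _)) => //= /imsetP[h _ ->]; apply: imset_f.
    by apply/eqP/setP => h; rewrite inE mem_imset.
  move=> _; rewrite embed_corank // /weight [#|~: _|]cardsCs setCK.
  have cD : #|[set g x | x : H]| = #|H| by rewrite card_imset.
  have leHG : (#|H| <= #|G|)%N := leq_card g g_inj.
  by rewrite cD card_imset // cards0; congr (a ^ _ * _); lia.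
move=> T TD; apply/setP => y; apply/imsetP/idP => [[h] | yT].
  by rewrite inE => ? ->.
have /imsetP[h _ yh] : y \in [set g x | x : H].
  by move/disjointFr: TD => /(_ y yT); rewrite inE => /negbFE.
by exists h => //; rewrite inE -yh.
Qed.

Lemma iso_bracket G H : mgraph_iso G H -> bracket_at G = bracket_at H.
Proof.
case=> f [f_bij f_adj f_loop f_mark f_free]; rewrite /bracket_at f_free; congr (_ * _).
rewrite (embed_state_sum (bij_inj f_bij)) //; congr state_sum.
apply/setP => y; rewrite !inE; apply/negbF; case: f_bij => g _ gK.
by rewrite -(gK y) imset_f.
Qed.

Lemma delete_bracket G (S : {set G}) :
  bracket_at (delete S) = loop_value ^+ free_loops G * state_sum S.
Proof.
pose g (x : delete S) : G := val x.
rewrite /bracket_at (embed_state_sum (g := g)) //; last exact: val_inj.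
congr (_ * state_sum _); apply/setP => y; rewrite inE.
apply/idP/idP => [| yS]; last first.
  by apply/imsetP => -[z _ yz]; have := valP z; rewrite /= -/(g z) -yz yS.
by apply: contraR => yS; apply/imsetP; exists (Sub y yS).
Qed.

Lemma lc_bracket G (v : G) : bracket_at (lc v) = bracket_at G.
Proof.
congr (_ * _); apply: eq_bigr => T _.
by congr (_ * _ ^+ _); apply: lc_corank.
Qed.

(** The diagonal entry depends on the sum of loop status and membership in [T], so complementing [T]
    undoes the toggling of loops. *)
Lemma mirror_corank G (T : {set G}) :
  corank (@adj (mirror G)) (state (set0 : {set mirror G}) (~: T : {set mirror G})) =
  corank adj (state set0 T).
Proof.
congr logn; apply: eq_n_solutions => // v.
by rewrite /state /diagonal /= !inE addNb addbN negbK.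
Qed.

Lemma unmarked_state G (T : {set G}) v : marking v = unmarked ->
  state set0 T v = Some (looped v (+) (v \in T)).
Proof. by move=> mv; rewrite /state inE /mark_state /diagonal mv /= addbF. Qed.

Lemma state_outside G (S T T' : {set G}) y :
  y \notin S -> (y \in T') = (y \in T) -> state set0 T' y = state S T y.
Proof. by rewrite /state inE /diagonal => /negbTE-> ->. Qed.

Lemma state_inside G (S T : {set G}) y : y \in S -> state S T y = None.
Proof. by rewrite /state => ->. Qed.

Lemma corank_state1 G (T T' : {set G}) v p :
    state set0 T' v = p ->
    (forall y, y \notin [set v] -> (y \in T') = (y \in T)) ->
  corank adj (state set0 T') = corank adj [eta state [set v] T with v |-> p].
Proof.
move=> <- TT'; congr logn; apply: eq_n_solutions => // y /=.
case: eqP => [->|/eqP yv] //; apply: state_outside; first by rewrite inE.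
by apply: TT'; rewrite inE.
Qed.

Lemma corank_state2 G (T T' : {set G}) v w p q :
    state set0 T' v = p -> state set0 T' w = q ->
    (forall y, y \notin [set v; w] -> (y \in T') = (y \in T)) ->
  corank adj (state set0 T') =
  corank adj [eta state [set v; w] T with v |-> p, w |-> q].
Proof.
move=> <- <- TT'; congr logn; apply: eq_n_solutions => // y /=.
case: eqP => [->|/eqP yv] //; case: eqP => [->|/eqP yw] //.
have yU : y \notin [set v; w] by rewrite !inE negb_or yv.
by apply: state_outside => //; apply: TT'.
Qed.

Lemma corank_state3 G e (T T' : {set G}) u v w p q r :
    state set0 T' u = p -> state set0 T' v = q -> state set0 T' w = r ->
    (forall y, y \notin [set u; v; w] -> (y \in T') = (y \in T)) ->
  corank e (state set0 T') =
  corank e [eta state [set u; v; w] T with u |-> p, v |-> q, w |-> r].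
Proof.
move=> <- <- <- TT'; congr logn; apply: eq_n_solutions => // y /=.
case: eqP => [->|/eqP yu] //; case: eqP => [->|/eqP yv] //; case: eqP => [->|/eqP yw] //.
have yU : y \notin [set u; v; w] by rewrite !inE !negb_or yu yv.
by apply: state_outside => //; apply: TT'.
Qed.

Lemma corank_none1 G (T : {set G}) v :
  corank adj [eta state [set v] T with v |-> None] = corank adj (state [set v] T).
Proof.
congr logn; apply: eq_n_solutions => // y /=.
by case: eqP => // ->; rewrite state_inside // inE.
Qed.

Lemma corank_none2 G (T : {set G}) v w :
  corank adj [eta state [set v; w] T with v |-> None, w |-> None] =
  corank adj (state [set v; w] T).
Proof.
congr logn; apply: eq_n_solutions => // y /=.
by do 2!(case: eqP => [->|_]; first by rewrite state_inside // !inE eqxx ?orbT).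
Qed.

Lemma sum_peel2 (V : finType) (M : zmodType) (F : {set V} -> M) v w : v != w ->
  \sum_(T : {set V} | [disjoint T & set0]) F T =
  \sum_(T : {set V} | [disjoint T & [set v; w]])
    ((F T + F (v |: T)) + (F (w |: T) + F (v |: (w |: T)))).
Proof.
move=> vw; rewrite (@sum_peel _ _ _ _ v) => [|T]; last by rewrite -!setI_eq0 !setI0.
rewrite (@sum_peel _ _ _ _ w) => [|T]; last first.
  by rewrite -!setI_eq0 !setI0 in_setU1 (negbTE vw).
apply: eq_bigl => T; rewrite -setI_eq0 setI0 eqxx disjoint_sym.
by rewrite disjoints_subset subUset !sub1set !inE.
Qed.

(** Diagonal entry 0 leaves x v free. Entry 1 forces x v = 0, whether [v] is kept (unmarked) or
    removed (marked u), so both marks behave alike. *)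
Lemma isolated_corank G (T T' : {set G}) v : (forall y : G, ~~ adj v y) ->
    marking v = unmarked \/ marking v = mu ->
    (forall y, y \notin [set v] -> (y \in T') = (y \in T)) ->
  corank adj (state set0 T') =
  (~~ (looped v (+) (v \in T')) + corank adj (state [set v] T))%N.
Proof.
move=> iso_v mark_v TT'; rewrite (corank_state1 (erefl _) TT') -corank_none1.
have -> : state set0 T' v = if looped v (+) (v \in T') then
    (if marking v is mu then None else Some true) else Some false.
  by case: mark_v => mv; rewrite /state inE /mark_state /diagonal mv /= addbF;
    case: (_ (+) _).
case: (_ (+) _); last exact: isolated_double (@adj_sym G) iso_v _.
by case: mark_v => -> //; apply: isolated_delete.
Qed.

(** With d the loop value, the two choices for [v] give a + a^-1 d = - a^-3 if [v] is looped and a d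
    + a^-1 = - a^3 if not. *)
Lemma state_sum_isolated G v : (forall y : G, ~~ adj v y) ->
    marking v = unmarked \/ marking v = mu ->
  state_sum (set0 : {set G}) =
  (if looped v then - a^-1 ^+ 3 else - a ^+ 3) * state_sum [set v].
Proof.
move=> iso_v mark_v; rewrite /state_sum (@sum_peel _ _ _ _ v) => [|T]; last first.
  by rewrite -!setI_eq0 !setI0.
rewrite big_distrr /=; apply: eq_big => T.
  by rewrite -!setI_eq0 setI0 eqxx /= setI_eq0 disjoint_sym disjoints1.
case/andP => _ vT.
rewrite weightU1 // (weight0 [set v]) cards1 expr1.
rewrite (isolated_corank (T := T) iso_v mark_v) //.
rewrite (isolated_corank (T := T) iso_v mark_v) => [|y]; last first.
  by rewrite !inE => /negbTE->.
rewrite !inE eqxx (negbTE vT) /= addbT addbF !exprD.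
have aV : a * a^-1 = 1 by rewrite mulrV.
have loopE : loop_value = - a^-1 ^+ 2 - a ^+ 2 by [].
move: loopE (weight _ T) (loop_value ^+ corank _ _); move: loop_value => L loopE W X.
by case: (looped v); rewrite /= ?expr0 ?expr1; ring: aV loopE.
Qed.

Lemma state_sum_twins G (v w : G) :
    looped v -> ~~ looped w -> marking v = unmarked -> marking w = unmarked ->
    same_outer_neighbors v w ->
  state_sum (set0 : {set G}) = state_sum [set v; w].
Proof.
move=> lv lw mv mw vw_twins.
have vw : v != w by apply: contraNneq lw => <-.
rewrite /state_sum (sum_peel2 _ vw); apply: eq_bigr => T.
rewrite disjoint_sym disjoints_subset subUset !sub1set !inE.
case/andP => vT wT; set U := [set v; w].
have -> := weightU1 set0 vT; have -> := weightU1 set0 wT.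
rewrite weightU1 ?in_setU1 ?(negbTE vw) // weightU1 // (weight0 U) cards2 vw.
have cE (T' : {set G}) : (forall y, y \notin U -> (y \in T') = (y \in T)) ->
    corank adj (state set0 T') = corank adj [eta state U T
      with v |-> Some (v \notin T'), w |-> Some (w \in T')].
  move=> TT'; apply: corank_state2 => //; rewrite unmarked_state //.
    by rewrite lv.
  by rewrite (negbTE lw).
rewrite !cE; try by move=> y; rewrite !inE negb_or => /andP[/negbTE yv /negbTE yw];
  rewrite ?yv ?yw.
rewrite !inE !eqxx (negbTE vw) eq_sym (negbTE vw) (negbTE vT) (negbTE wT) /=.
rewrite -corank_none2 -/U.
have swap := twins_swap (@adj_sym G) (@adj_irr G) vw vw_twins (state U T).
have double := twins_double (@adj_sym G) (@adj_irr G) vw vw_twins (state U T).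
have del := twins_delete (@adj_sym G) (@adj_irr G) vw vw_twins (state U T).
have aV : a * a^-1 = 1 by rewrite mulrV.
have loopE : loop_value = - a^-1 ^+ 2 - a ^+ 2 by [].
(* Of the four states on {v, w}, two have equal corank, with common term X say, one gives d X and
   one gives the term Y of the deletion. The total is (a^2 + a^-2 + d) X + Y = Y, whether or not [v]
   and [w] are adjacent. *)
move: swap double del; case: (adj v w) => /= -> -> ->;
  rewrite [loop_value ^+ _.+1]exprS; do 2!move: (loop_value ^+ corank _ _) => ?;
  by move: loopE (weight _ T); move: loop_value => L loopE W; ring: aV loopE.
Qed.

Lemma state_sum_edge G (v w : G) :
    looped v -> ~~ looped w -> marking v = mc -> marking w = unmarked ->
    (forall y, adj w y = (y == v)) -> (forall y, adj v y = (y == w)) ->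
  state_sum (set0 : {set G}) = loop_value * state_sum [set v; w].
Proof.
move=> lv lw mv mw nbr_w nbr_v.
have vw : v != w by apply: contraNneq lw => <-.
rewrite /state_sum (sum_peel2 _ vw) big_distrr /=; apply: eq_bigr => T.
rewrite disjoint_sym disjoints_subset subUset !sub1set !inE.
case/andP => vT wT; set U := [set v; w].
have -> := weightU1 set0 vT; have -> := weightU1 set0 wT.
rewrite weightU1 ?in_setU1 ?(negbTE vw) // weightU1 // (weight0 U) cards2 vw.
have cE (T' : {set G}) : (forall y, y \notin U -> (y \in T') = (y \in T)) ->
    corank adj (state set0 T') = corank adj [eta state U T
      with v |-> (if v \in T' then None else Some true), w |-> Some (w \in T')].
  move=> TT'; apply: corank_state2 => //; last by rewrite unmarked_state ?(negbTE lw).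
  by rewrite /state inE /mark_state /diagonal mv /= lv addbF; case: (v \in T').
rewrite !cE; try by move=> y; rewrite !inE negb_or => /andP[/negbTE yv /negbTE yw];
  rewrite ?yv ?yw.
rewrite !inE !eqxx (negbTE vw) eq_sym (negbTE vw) (negbTE vT) (negbTE wT) /=.
rewrite -corank_none2 -/U.
have del := edge_delete vw nbr_v nbr_w (state U T).
have double := edge_double (@adj_sym G) vw nbr_v nbr_w (state U T).
(* In the order empty set, {v}, {w}, {v, w}, the states contribute a^2, d, d and a^-2 times the term
   of the deletion, and the sum of these factors is d. For {v} the local solutions are spanned by
   (0, 1), for {w} by (1, 1). *)
rewrite (del (Some true) (Some false)); last by do 2!case.
rewrite (double None (Some false) false); [|by do 2!case|by do 2!case].
rewrite (double (Some true) (Some true) true); [|by do 2!case|by do 2!case].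
rewrite (del None (Some true)); last by do 2!case.
have aV : a * a^-1 = 1 by rewrite mulrV.
have loopE : loop_value = - a^-1 ^+ 2 - a ^+ 2 by [].
rewrite [loop_value ^+ _.+1]exprS; move: (loop_value ^+ corank _ _) => ?.
by move: loopE (weight _ T); move: loop_value => L loopE W; ring: aV loopE.
Qed.

Lemma state_sum_triangle G (u v w : G) :
    marking u = unmarked -> marking v = unmarked -> marking w = unmarked ->
    adj u v -> adj u w -> adj v w -> looped u -> ~~ looped v -> ~~ looped w ->
    (forall x, x \notin [set u; v; w] -> adj x u (+) adj x v (+) adj x w = false) ->
  state_sum (set0 : {set G}) = state_sum (set0 : {set cut_edges [set u; v; w]}).
Proof.
move=> mu_ mv mw auv auw avw lu lv lw even; set U := [set u; v; w].
have uv : u != v by apply: contraTneq auv => ->; rewrite adj_irr.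
have uw : u != w by apply: contraTneq auw => ->; rewrite adj_irr.
have vw : v != w by apply: contraTneq avw => ->; rewrite adj_irr.
pose tri := triangle adj u v w.
(* [S true] and [S false] are the state sums before and after the move. *)
pose S t := \sum_(T : {set G}) weight set0 T * loop_value ^+ corank (tri t) (state set0 T).
have -> : state_sum (set0 : {set G}) = S true.
  apply: eq_big => T; first by rewrite -setI_eq0 setI0 eqxx.
  move=> _; congr (_ * _ ^+ logn _ _); apply: eq_n_solutions => // x y.
  rewrite /tri /triangle; case: ifP => // /andP[].
  by rewrite !inE -!orbA => /or3P[] /eqP-> /or3P[] /eqP->;
    rewrite ?eqxx ?adj_irr ?auv ?auw ?avw ?(adj_sym v u) ?(adj_sym w u) ?(adj_sym w v)
      ?auv ?auw ?avw ?uv ?uw ?vw //= eq_sym ?uv ?uw ?vw.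
have -> : state_sum (set0 : {set cut_edges U}) = S false.
  apply: eq_big => T; first by rewrite -setI_eq0 setI0 eqxx.
  move=> _; congr (_ * _ ^+ logn _ _); apply: eq_n_solutions => // x y /=.
  by rewrite /cut_adj /tri /triangle; case: (_ && (_ \in _)); rewrite ?andbF ?andbT.
have peel t : S t = \sum_(T : {set G} | (u \notin T) && (v \notin T) && (w \notin T))
    (let F (T : {set G}) := weight set0 T * loop_value ^+ corank (tri t) (state set0 T) in
     let F1 T := F T + F (u |: T) in let F2 T := F1 T + F1 (v |: T) in F2 T + F2 (w |: T)).
  rewrite /S (@sum_peel _ _ _ _ u) //= (@sum_peel _ _ _ _ v) => [|T]; last first.
    by rewrite !inE (negbTE uv).
  rewrite (@sum_peel _ _ _ _ w) // => T.
  by rewrite !inE (negbTE uw) (negbTE vw).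
rewrite !peel; apply: eq_bigr => T /andP[/andP[uT vT] wT] /=.
have cE t (T' : {set G}) : (forall y, y \notin U -> (y \in T') = (y \in T)) ->
    corank (tri t) (state set0 T') = corank (tri t) [eta state U T
      with u |-> Some (u \notin T'), v |-> Some (v \in T'), w |-> Some (w \in T')].
  move=> TT'; apply: corank_state3 => //; rewrite unmarked_state //.
  - by rewrite lu.
  - by rewrite (negbTE lv).
  by rewrite (negbTE lw).
rewrite !cE; try by move=> y; rewrite !inE !negb_or -andbA =>
  /and3P[/negbTE yu /negbTE yv /negbTE yw]; rewrite ?yu ?yv ?yw.
rewrite !inE !eqxx !(eq_sym v u) !(eq_sym w u) !(eq_sym w v).
rewrite (negbTE uv) (negbTE uw) (negbTE vw) (negbTE uT) (negbTE vT) (negbTE wT) /=.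
rewrite !weightU1 ?inE ?negb_or ?uv ?uw ?vw ?uT ?vT ?wT //.
have e000 := triangle_000 (@adj_sym G) uv uw vw even _ (state U T).
have e100 := triangle_100 (@adj_sym G) uv uw vw even _ (state U T).
have e010 := triangle_010 (@adj_sym G) uv uw vw even _ (state U T).
have e111 := triangle_111 (@adj_sym G) uv uw vw even _ (state U T).
have e110 := triangle_110 (@adj_sym G) uv uw vw even true (state U T).
have e101 := triangle_101 (@adj_sym G) uv uw vw even true (state U T).
have e011 := triangle_011 (@adj_sym G) uv uw vw even true (state U T).
rewrite !(e000, e100, e010, e111, e110, e101, e011) /=.
have aV : a * a^-1 = 1 by rewrite mulrV.
have loopE : loop_value = - a^-1 ^+ 2 - a ^+ 2 by [].
(* Let X(t) be the term of the states 001. The states 110, 101 and 011 contribute equally to both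
   sides. Up to a common factor the others give X(t) (1 + a^-2 d + 2 a^-4) + X(~~ t) a^-4 = a^-4
   (X(t) + X(~~ t)), which is symmetric in t. *)
rewrite ![loop_value ^+ _.+1]exprS; do 5!move: (loop_value ^+ corank _ _) => ?.
by move: loopE (weight _ T); move: loop_value => L loopE W; ring: aV loopE.
Qed.

End StateSums.

(** * The marked pivot in moves Omega.2 (b) and (c) *)

Section Pivots.

Variables (G : mgraph) (v w z : G).
Hypotheses (vw : v != w) (mv : marking v = mc) (mw : marking w = unmarked).
Hypotheses (z_vw : z \notin [set v; w]) (avz : adj v z) (avw : adj v w).

Let e1 : rel G := lc_adj v.
Let e2 : rel G := @lc_adj (lc v) z.
Let e3 : rel G := @lc_adj (@lc (lc v) z) v.

Let e1E x y : e1 x y = adj x y (+) [&& x != y, adj v x & adj v y].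
Proof. by []. Qed.

Let e2E x y : e2 x y = e1 x y (+) [&& x != y, e1 z x & e1 z y].
Proof. by []. Qed.

Let e3E x y : e3 x y = e2 x y (+) [&& x != y, e2 v x & e2 v y].
Proof. by []. Qed.

Let e1v y : e1 v y = adj v y.
Proof. by rewrite e1E adj_irr andbF addbF. Qed.

Let e1zv : e1 z v.
Proof. by rewrite e1E adj_irr !andbF addbF adj_sym. Qed.

Let e2v y : v != y -> e2 v y = adj v y (+) e1 z y.
Proof. by move=> vy; rewrite e2E e1v vy e1zv. Qed.

Let e2vw : e2 v w = ~~ e1 z w.
Proof. by rewrite e2v // avw. Qed.

(** The successive marks of [v] are c, cr, u and unmarked. *)
Lemma pivot_marking_l : @marking (pivot v z) v = unmarked.
Proof.
have vz : (v == z) = false.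
  by apply/negbTE; move: z_vw; rewrite !inE negb_or eq_sym => /andP[].
change (@lc_marking (@lc (lc v) z) v v = unmarked).
rewrite /lc_marking eqxx.
change (mark_lc_self (@lc_marking (lc v) z v) = unmarked).
rewrite /lc_marking vz.
change (mark_lc_self (if e1 z v then mark_lc_neighbor (@lc_marking G v v)
  else @lc_marking G v v) = unmarked).
by rewrite e1zv /lc_marking eqxx mv.
Qed.

(** The first complementation toggles r at [w], and exactly one of the other two toggles it back,
    because [e2 v w] is the negation of [e1 z w]. *)
Lemma pivot_marking_r : @marking (pivot v z) w = unmarked.
Proof.
have wz : (w == z) = false.
  by apply/negbTE; move: z_vw; rewrite !inE negb_or ![z == _]eq_sym => /andP[].
have wv : (w == v) = false by rewrite eq_sym (negbTE vw).
change (@lc_marking (@lc (lc v) z) v w = unmarked).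
rewrite /lc_marking wv.
change ((if e2 v w then mark_lc_neighbor (@lc_marking (lc v) z w)
  else @lc_marking (lc v) z w) = unmarked).
rewrite e2vw /lc_marking wz.
change ((if ~~ e1 z w then mark_lc_neighbor
    (if e1 z w then mark_lc_neighbor (@lc_marking G v w) else @lc_marking G v w)
  else if e1 z w then mark_lc_neighbor (@lc_marking G v w) else @lc_marking G v w)
    = unmarked).
by rewrite /lc_marking wv avw mw; case: (e1 z w).
Qed.

(** Writing pq for [adj p q], the new adjacencies of [v] and [w] to an outer x are vx + e1 z x and
    wx + (1 + wz) vx + e1 z x. They agree if wx = wz = 0, and also if wx = vx and wz = 1. *)
Lemma pivot_twins :
    (forall x, adj w x = (x == v)) \/ same_outer_neighbors v w /\ adj w z ->
  @same_outer_neighbors (pivot v z) v w.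
Proof.
move=> nbr_w x; rewrite !inE negb_or => /andP[xv xw].
have [zv zw] : z != v /\ z != w by move: z_vw; rewrite !inE negb_or => /andP[].
change (e3 v x = e3 w x); rewrite !e3E.
have -> : e2 v v = false by apply: (@lc_adj_irr (lc v) z).
have e1zw : e1 z w = ~~ adj w z by rewrite e1E zw avz avw addbT adj_sym.
rewrite andbF addbF e2vw e2v 1?eq_sym // (e2E w) (e1E w) e1zw avw.
rewrite ![_ == x]eq_sym xw /=.
case: nbr_w => [nbr_w | [twins wz]].
  by rewrite !nbr_w (negbTE xv) (negbTE zv) /=; case: (adj v x); case: (e1 z x).
rewrite wz -twins ?inE ?negb_or ?xv //=.
by case: (adj v x); case: (e1 z x).
Qed.

End Pivots.

(** * Mirror images and invariance of the bracket under moves *)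

Local Open Scope ring_scope.

(** Complementing [T] changes the sign of the exponent n - 2|T|, and the loop value is symmetric in
    a and a^-1. *)
Lemma mirror_bracket (R : comUnitRingType) (a : R) (G : mgraph) :
  bracket_at a (mirror G) = bracket_at a^-1 G.
Proof.
have loopV : loop_value a^-1 = loop_value a by rewrite /loop_value invrK addrC.
rewrite /bracket_at loopV; congr (_ * _); rewrite /state_sum loopV.
rewrite (reindex_inj (@setC_inj G)) /=; apply: eq_big => T.
  by rewrite -!setI_eq0 !setI0.
move=> _; congr (_ * _ ^+ _); last exact: mirror_corank.
rewrite /weight exprz_inv; congr (a ^ _).
have cT : (#|T| + #|~: T| = #|G|)%N := cardsC T.
change (#|G|%:Z - #|(set0 : {set G})|%:Z - #|~: T|%:Z *+ 2 =
  - (#|G|%:Z - #|(set0 : {set G})|%:Z - #|T|%:Z *+ 2)).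
by rewrite cards0; lia.
Qed.

(* #|G| - 2 n_looped G, without subtraction; this also fixes the parity of #|G|. *)
Definition same_writhe (G H : mgraph) : Prop :=
  (#|G| + (n_looped H).*2 = #|H| + (n_looped G).*2)%N.

(** Quantifying over all units makes the relation stable under mirror images. The second component
    controls the sign and the power of t in the Jones polynomial. *)
Definition bracket_equiv (G H : mgraph) : Prop :=
  (forall (R : comUnitRingType) (a : R), a \is a GRing.unit ->
     bracket_at a G = bracket_at a H) /\ same_writhe G H.

Lemma bracket_equiv_sym G H : bracket_equiv G H -> bracket_equiv H G.
Proof.
by case=> eb ew; split=> [R a ua|]; [rewrite eb | apply: esym].
Qed.

Lemma bracket_equiv_trans G H K :
  bracket_equiv G H -> bracket_equiv H K -> bracket_equiv G K.
Proof.
case=> eb ew [eb' ew']; split=> [R a ua|]; first by rewrite eb ?eb'.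
by rewrite /same_writhe in ew ew' *; lia.
Qed.

Lemma iso_counts G H : mgraph_iso G H -> #|G| = #|H| /\ n_looped G = n_looped H.
Proof.
case=> f [f_bij _ f_loop _ _]; split; first exact: bij_eq_card f_bij.
rewrite /n_looped -[RHS](on_card_preimset (onW_bij _ f_bij)).
by apply: eq_card => x; rewrite !inE f_loop.
Qed.

Lemma iso_equiv G H : mgraph_iso G H -> bracket_equiv G H.
Proof.
move=> iGH; split=> [R a ua|]; first exact: iso_bracket.
by rewrite /same_writhe; have [-> ->] := iso_counts iGH.
Qed.

Lemma delete_card (G : mgraph) (S : {set G}) : (#|delete S| + #|S| = #|G|)%N.
Proof.
rewrite -(cardsC S) addnC; congr (_ + _)%N; rewrite card_sig.
by apply: eq_card => x; rewrite !inE.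
Qed.

Lemma delete_n_looped (G : mgraph) (S : {set G}) :
  (n_looped (delete S) + #|[set v in S | looped v]| = n_looped G)%N.
Proof.
rewrite /n_looped -(cardsID S [set v | looped v]) addnC; congr (_ + _)%N.
  by apply: eq_card => x; rewrite !inE andbC.
rewrite -(card_imset (mem [set v : delete S | looped v]) val_inj).
apply: eq_card => x; rewrite !inE; apply/imsetP/andP => [[y] | [xS lx]].
  by rewrite inE => ly ->; split; first exact: valP y.
by exists (Sub x xS); rewrite ?inE.
Qed.

Lemma delete2_writhe (G : mgraph) (v w : G) :
  looped v -> ~~ looped w -> same_writhe G (delete [set v; w]).
Proof.
move=> lv lw; have vw : v != w by apply: contraNneq lw => <-.
have := delete_card [set v; w]; have := delete_n_looped [set v; w].
have -> : [set x in [set v; w] | looped x] = [set v].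
  apply/setP => x; rewrite !inE; case: (eqVneq x v) => [-> | _] //=.
  by case: eqP => // ->; apply/negbTE.
by rewrite cards1 cards2 vw /same_writhe; lia.
Qed.

Lemma omega2a_equiv G H : omega2a G H -> bracket_equiv G H.
Proof.
case=> v [w [lv lw [mv mw] tw /iso_equiv]]; apply: bracket_equiv_trans.
split=> [R a ua|]; last exact: delete2_writhe.
by rewrite delete_bracket // /bracket_at (state_sum_twins ua lv lw).
Qed.

Lemma omega2d_equiv G H : omega2d G H -> bracket_equiv G H.
Proof.
case=> v [w [[lv lw] [mv mw] nw nv /iso_equiv]]; apply: bracket_equiv_trans.
split=> [R a ua|]; last exact: (@delete2_writhe (add_free_loop G) v w).
(* The factor contributed by the isolated edge is that of the additional free loop. *)
rewrite [RHS](@delete_bracket R a ua (add_free_loop G)) [LHS]/bracket_at.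
by rewrite (state_sum_edge ua lv lw mv mw nw nv) mulrA -exprSr.
Qed.

Lemma lc_equiv (G : mgraph) (v : G) : bracket_equiv (lc v) G.
Proof. by split=> [R a _|//]; apply: lc_bracket. Qed.

Lemma pivot_equiv (G : mgraph) (v w : G) : bracket_equiv G (pivot v w).
Proof.
apply: bracket_equiv_sym; apply: (bracket_equiv_trans (lc_equiv _)).
by apply: (bracket_equiv_trans (lc_equiv _)); apply: lc_equiv.
Qed.

Lemma omega2_reduce_equiv G H : omega2_reduce G H -> bracket_equiv G H.
Proof.
case.
- exact: omega2a_equiv.
- case=> v [w [z [[lv lw] [mv mw] nw [zvw avz] i]]].
  have vw : v != w by apply: contraNneq lw => <-.
  have avw : adj v w by rewrite adj_sym nw.
  apply: bracket_equiv_trans (pivot_equiv v z) _; apply: omega2a_equiv.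
  exists v, w; split=> //; last by apply: pivot_twins => //; left.
  by split; [apply: (pivot_marking_l mv zvw avz) | apply: pivot_marking_r].
- case=> v [w [z [[lv lw] [mv mw] [avw tw] [zvw [avz awz]] i]]].
  have vw : v != w by apply: contraNneq lw => <-.
  apply: bracket_equiv_trans (pivot_equiv v z) _; apply: omega2a_equiv.
  exists v, w; split=> //; last by apply: pivot_twins => //; right.
  by split; [apply: (pivot_marking_l mv zvw avz) | apply: pivot_marking_r].
exact: omega2d_equiv.
Qed.

Lemma omega2_equiv G H : omega2 G H -> bracket_equiv G H.
Proof.
by case=> /omega2_reduce_equiv // /bracket_equiv_sym.
Qed.

Lemma omega3_basic_equiv G H : omega3_basic G H -> bracket_equiv G H.
Proof.
case=> u [v [w [[mu_ mv mw] [uv uw vw] [lu lv lw] even /iso_equiv]]].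
apply: bracket_equiv_trans; split=> [R a ua|//].
rewrite /bracket_at; congr (_ * _); apply: state_sum_triangle => // x /even.
by case: (adj x u); case: (adj x v); case: (adj x w) => -[].
Qed.

Lemma mirror_n_looped G : (n_looped (mirror G) + n_looped G = #|G|)%N.
Proof.
rewrite addnC -(cardsC [set v : G | looped v]); congr (_ + _)%N.
by apply: eq_card => x; rewrite !inE.
Qed.

Lemma mirror_equiv G H : bracket_equiv (mirror G) (mirror H) -> bracket_equiv G H.
Proof.
case=> eb ew; split=> [R a ua|].
  by have := eb R a^-1; rewrite !mirror_bracket invrK unitrV; apply.
have := mirror_n_looped G; have := mirror_n_looped H.
have {}ew : (#|G| + (n_looped (mirror H)).*2 = #|H| + (n_looped (mirror G)).*2)%N := ew.
by rewrite /same_writhe; lia.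
Qed.

Lemma omega3_equiv G H : omega3 G H -> bracket_equiv G H.
Proof.
elim=> {G H} [G H | G H _ | G H K gh _ | G H K _ gh hk | G H _].
- exact: omega3_basic_equiv.
- exact: bracket_equiv_sym.
- exact/bracket_equiv_trans/omega2_equiv.
- exact/(bracket_equiv_trans gh)/omega2_equiv.
exact: mirror_equiv.
Qed.

Lemma lc_sequence_equiv G H : lc_sequence G H -> bracket_equiv G H.
Proof.
elim=> {G H} [G | G v H _]; first by split.
exact/bracket_equiv_trans/bracket_equiv_sym/lc_equiv.
Qed.

Lemma move_equiv move G H : (forall G H, move G H -> bracket_equiv G H) ->
  marked_graph_move move G H -> bracket_equiv G H.
Proof.
move=> m [G' [H' [/lc_sequence_equiv gg /m mGH /lc_sequence_equiv hh]]].
exact: bracket_equiv_trans gg (bracket_equiv_trans mGH hh).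
Qed.

(** * Specialization to Laurent polynomials *)

Lemma lX_unit : lX \is a GRing.unit.
Proof.
apply/unitrPr; exists (mklaurent 1 1); apply: lfrac_inj.
rewrite [LHS]lfracM [RHS]lfrac1 !lfracE expr0 divr1 expr1 tofrac1 mul1r.
by rewrite divff // (fracX_neq0 1).
Qed.

Lemma reduced_bracketE (G : mgraph) : reduced_bracket G = bracket_at lX G.
Proof.
have red i : mmap intr reduction 'X_i = reduction i :> laurent by rewrite mmapX mmap1U.
have redA : mmap intr reduction brA = lX :> laurent.
  by rewrite /brA red /reduction inordK.
have redB : mmap intr reduction brB = lX^-1 :> laurent.
  by rewrite /brB red /reduction inordK.
have redd : mmap intr reduction brd = loop_value lX :> laurent.
  by rewrite /brd red /reduction inordK // /loop_value exprVn.
rewrite /reduced_bracket /bracket rmorphM rmorphXn /= redd; congr (_ * _).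
rewrite rmorph_sum /=; apply: eq_big => T; first by rewrite -setI_eq0 setI0 eqxx.
move=> _; rewrite !rmorphM !rmorphXn /= redA redB redd nullity_corank; congr (_ * _).
rewrite /weight cards0; have leTG : (#|T| <= #|G|)%N := max_card (mem T).
have -> : #|G|%:Z - 0%N%:Z - #|T|%:Z *+ 2 = (#|G| - #|T|)%N%:Z + - #|T|%:Z by lia.
by rewrite exprzDr ?lX_unit // -exprz_inv.
Qed.

Section Evaluation.

Variables (S : comUnitRingType) (s : S).
Hypothesis s_unit : s \is a GRing.unit.

(** Evaluation does not see the reduction to lowest terms, as each cancelled factor X contributes s
    / s = 1. Multiplicativity of [leval] follows from this. *)
Lemma leval_mklaurent p k : leval (mklaurent p k) s = (map_poly intr p).[s] / s ^+ k.
Proof.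
rewrite /leval /lnum /lden /=; elim: k p => [|k IHk] p //=.
case: ifP => // /eqP p0; rewrite IHk -[in RHS](poly_take_drop 1 p).
have -> : take_poly 1 p = 0.
  by apply/polyP=> -[|i]; rewrite coef_take_poly coef0.
rewrite add0r rmorphM /= map_polyXn hornerM hornerXn expr1 exprS.
by rewrite invrM ?unitrX // [_^-1 * _]mulrC mulrA mulrK.
Qed.

Lemma levalM p q : leval (p * q) s = leval p s * leval q s.
Proof.
rewrite [p * q]/(lmul p q) leval_mklaurent rmorphM hornerM exprD.
by rewrite invrM ?unitrX // /leval [_^-1 * _^-1]mulrC mulrACA.
Qed.

Lemma levalN p : leval (- p) s = - leval p s.
Proof. by rewrite [- p]/(lopp p) leval_mklaurent rmorphN hornerN mulNr. Qed.

Lemma leval1 : leval 1 s = 1.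
Proof. by rewrite leval_mklaurent rmorph1 hornerC expr0 divr1. Qed.

Lemma leval_lX : leval lX s = s.
Proof. by rewrite leval_mklaurent map_polyX hornerX expr0 divr1. Qed.

Lemma leval_lXV : leval lX^-1 s = s^-1.
Proof.
by apply: (mulIr s_unit); rewrite mulVr // -{2}leval_lX -levalM mulVr ?lX_unit ?leval1.
Qed.

Lemma levalX p n : leval (p ^+ n) s = leval p s ^+ n.
Proof. by elim: n => [|n IHn]; rewrite ?leval1 // !exprS levalM IHn. Qed.

End Evaluation.

(** * The Jones polynomial *)

Lemma equiv_jones G H : bracket_equiv G H -> jones G = jones H.
Proof.
case=> eb ew; rewrite /jones !reduced_bracketE (eb _ _ lX_unit).
rewrite /same_writhe in ew; congr (_ * _ ^ _ * _); last by lia.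
(* The sign depends only on the parity of the number of vertices, which [ew] determines. *)
by rewrite -signr_odd -[RHS]signr_odd; congr (_ ^+ _); lia.
Qed.

(** The isolated vertex multiplies the bracket by - A^-3 or - A^3. With A = [lX^-1] this cancels
    against the sign of the extra vertex and its share 3 - 6 = -3 (looped) or 3 (unlooped) of the
    exponent. *)
Lemma omega1_remove_jones G H : omega1_remove G H -> jones G = jones H.
Proof.
case=> v [iso_v mark_v /iso_equiv/equiv_jones <-].
have lXVu : lX^-1 \is a GRing.unit by rewrite unitrV lX_unit.
have lXu := lX_unit.
rewrite /jones !reduced_bracketE [bracket_at _ G]/bracket_at delete_bracket //.
rewrite (state_sum_isolated lX_unit iso_v mark_v) !levalM //.
have := delete_card [set v]; have := delete_n_looped [set v]; rewrite cards1.
have -> : [set x in [set v] | looped x] = if looped v then [set v] else set0.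
  apply/setP => x; rewrite !inE; case: eqP => [->|].
    by case: (looped v); rewrite !inE ?eqxx.
  by case: (looped v); rewrite !inE // => /eqP/negbTE.
set H' := delete _; set n := #|H'|; set m := n_looped H'.
have -> : leval (if looped v then - lX^-1 ^+ 3 else - lX ^+ 3) lX^-1 =
    - lX ^ (if looped v then 3 else - 3 : int).
  case: (looped v); rewrite levalN // levalX // ?leval_lXV ?leval_lX // ?invrK //.
  by rewrite exprVn -exprnN.
move=> m_eq n_eq; have -> : 3 * #|G|%:Z - 6 * (n_looped G)%:Z =
    (3 * n%:Z - 6 * m%:Z) + (if looped v then - 3 else 3 : int).
  by rewrite -n_eq -m_eq; case: (looped v); rewrite ?cards1 ?cards0; lia.
rewrite -n_eq addn1 exprS exprzDr //.
have : lX ^ (if looped v then - 3 else 3 : int) *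
    lX ^ (if looped v then 3 else - 3 : int) = 1.
  by rewrite -exprzDr //; case: (looped v).
move: (lX ^ (if _ then - 3 else 3)) (lX ^ (if _ then 3 else _)) => z z' zz'.
rewrite /bracket_at.
move: (lX ^ _) ((-1) ^+ n) (leval _ _) (leval _ _) => x y X Y.
by ring: zz'.
Qed.

Lemma omega1_jones G H : omega1 G H -> jones G = jones H.
Proof. by case=> /omega1_remove_jones. Qed.

Theorem theorem24 :
  [/\ forall (G : mgraph) (v : G),
        reduced_bracket (lc v) = reduced_bracket G,
      forall G H : mgraph,
        marked_graph_move omega2 G H -> reduced_bracket G = reduced_bracket H
    & forall G H : mgraph,
        marked_graph_move omega3 G H -> reduced_bracket G = reduced_bracket H]
  /\
  [/\ forall (G : mgraph) (v : G),
        jones (lc v) = jones G,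
      forall G H : mgraph, marked_graph_move omega1 G H -> jones G = jones H,
      forall G H : mgraph, marked_graph_move omega2 G H -> jones G = jones H
    & forall G H : mgraph, marked_graph_move omega3 G H -> jones G = jones H].
Proof.
have bracket_eq G H : bracket_equiv G H -> reduced_bracket G = reduced_bracket H.
  by case=> eb _; rewrite !reduced_bracketE eb ?lX_unit.
split; split.
- by move=> G v; apply/bracket_eq/lc_equiv.
- by move=> G H /(move_equiv omega2_equiv)/bracket_eq.
- by move=> G H /(move_equiv omega3_equiv)/bracket_eq.
- by move=> G v; apply/equiv_jones/lc_equiv.
- move=> G H [G' [H' [/lc_sequence_equiv gg m /lc_sequence_equiv hh]]].
  by rewrite (equiv_jones gg) (omega1_jones m) (equiv_jones hh).
- by move=> G H /(move_equiv omega2_equiv)/equiv_jones.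
by move=> G H /(move_equiv omega3_equiv)/equiv_jones.
Qed.
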